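(* Let $\alpha\in(\tfrac12,1)$ and $\eta_t=\eta_0t^{-\alpha}$. For every $\delta\in(0,1)$ there exists $\eta_0>0$ (depending on $\delta$ and problem parameters but not on $T$) such that, for every $T$, with probability at least $1-\delta$, simultaneously for all $t\in\{1,\dots,T\}$, $$\|\Delta_t\|_2\lesssim \frac{\eta_0}{\sqrt{2\alpha-1}}\left(\frac{(1-\gamma)\lambda_0\eta_0}{4\alpha}\right)^{-\frac{\alpha}{2(1-\alpha)}}\sqrt{\log\frac{9T}{\delta}}\,(2\|\theta^\star\|_2+1)\,t^{-\alpha/2}.$$
   Context: Setting: $\mathcal S$ is a finite state space, $\gamma\in[0,1)$ a discount factor, $P(\cdot\mid s)$ a Markov transition kernel on $\mathcal S$ (induced by a fixed policy) with unique stationary distribution $\mu$, and $r:\mathcal S\to[0,1]$ the expected reward. A feature map $\phi:\mathcal S\to\mathbb R^d$ satisfies $\|\phi(s)\|_2\le1$ for all $s$. Define $A=\mathbb E_{s\sim\mu,s'\sim P(\cdot\mid s)}[\phi(s)(\phi(s)-\gamma\phi(s'))^\top]$, $b=\mathbb E_{s\sim\mu}[\phi(s)r(s)]$, $\Sigma=\mathbb E_{s\sim\mu}[\phi(s)\phi(s)^\top]$, $\lambda_0=\lambda_{\min}(\Sigma)$ (assumed $>0$), $\lambda_\Sigma=\lambda_{\max}(\Sigma)$, $\theta^\star=A^{-1}b$. Samples: $(s_t,s_t',r_t)$, $t=1,2,\dots$, are i.i.d. with $s_t\sim\mu$, $s_t'\sim P(\cdot\mid s_t)$, $r_t\in[0,1]$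 with $\mathbb E[r_t\mid s_t]=r(s_t)$; set $A_t=\phi(s_t)(\phi(s_t)-\gamma\phi(s_t'))^\top$, $b_t=r_t\phi(s_t)$. TD iterates: $\theta_0=0$, $\theta_t=\theta_{t-1}-\eta_t(A_t\theta_{t-1}-b_t)$; $\Delta_t=\theta_t-\theta^\star$. The symbol $\lesssim$ means inequality up to a universal constant. *)

(* Defs.v *)
From HB Require Import structures.
From mathcomp Require Import all_boot all_order all_algebra.
From mathcomp Require Import all_classical all_reals all_analysis.
Set Implicit Arguments. Unset Strict Implicit. Unset Printing Implicit Defensive.
Import Order.TTheory GRing.Theory Num.Theory.
Local Open Scope classical_set_scope.
Local Open Scope ring_scope.

Section TD.
Variable R : realType.

Definition norm2 (d : nat) (v : 'cV[R]_d) : R := Num.sqrt (\sum_i (v i 0) ^+ 2).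

Variables (S : finType) (d : nat).

Definition is_kernel (Pk : S -> S -> R) : Prop :=
  (forall a b, 0 <= Pk a b) /\ (forall a, \sum_b Pk a b = 1).

Definition is_distr (nu : S -> R) : Prop :=
  (forall a, 0 <= nu a) /\ \sum_a nu a = 1.

Definition is_stationary (Pk : S -> S -> R) (nu : S -> R) : Prop :=
  is_distr nu /\ forall b, \sum_a nu a * Pk a b = nu b.

Definition unique_stationary (Pk : S -> S -> R) (mu : S -> R) : Prop :=
  is_stationary Pk mu /\ forall nu, is_stationary Pk nu -> nu = mu.

Definition TD_A (gamma : R) (Pk : S -> S -> R) (mu : S -> R) (phi : S -> 'cV[R]_d)
  : 'M[R]_d :=
  \sum_a \sum_b (mu a * Pk a b) *: (phi a *m (phi a - gamma *: phi b)^T).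

Definition TD_b (mu : S -> R) (r : S -> R) (phi : S -> 'cV[R]_d) : 'cV[R]_d :=
  \sum_a (mu a * r a) *: phi a.

Definition TD_Sigma (mu : S -> R) (phi : S -> 'cV[R]_d) : 'M[R]_d :=
  \sum_a mu a *: (phi a *m (phi a)^T).

Definition is_lambda_min (M : 'M[R]_d) (lam : R) : Prop :=
  eigenvalue M lam /\ forall a, eigenvalue M a -> lam <= a.

Definition theta_star (gamma : R) (Pk : S -> S -> R) (mu : S -> R) (r : S -> R)
  (phi : S -> 'cV[R]_d) : 'cV[R]_d :=
  invmx (TD_A gamma Pk mu phi) *m TD_b mu r phi.

Fixpoint TD_iter (gamma : R) (phi : S -> 'cV[R]_d) (eta : nat -> R)
  (s s' : nat -> S) (rw : nat -> R) (t : nat) : 'cV[R]_d :=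
  match t with
  | 0 => 0
  | t'.+1 =>
      let th := TD_iter gamma phi eta s s' rw t' in
      let At := phi (s t) *m (phi (s t) - gamma *: phi (s' t))^T in
      let bt := rw t *: phi (s t) in
      th - eta t *: (At *m th - bt)
  end.

End TD.

Section Prob.
Context {R : realType} {dO : measure_display} {Omega : measurableType dO}.
Variable (P : probability Omega R).

Definition prob (E : set Omega) : R := fine (P E).

Variables (S : finType) (s s' : nat -> Omega -> S) (rw : nat -> Omega -> R).

Definition sample_event (t : nat) (a b : S) (B : set R) : set Omega :=
  [set w | s t w = a /\ s' t w = b /\ B (rw t w)].

Definition iid_samples : Prop :=
  (forall t a, measurable [set w | s t w = a]) /\
  (forall t a, measurable [set w | s' t w = a]) /\
  (forall t, measurable_fun setT (rw t)) /\
  (forall (I : seq nat) (a b : nat -> S) (B : nat -> set R),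
      uniq I -> all (fun i => 0 < i)%N I -> (forall i, measurable (B i)) ->
      prob (\big[setI/setT]_(i <- I) sample_event i (a i) (b i) (B i))
      = \prod_(i <- I) prob (sample_event i (a i) (b i) (B i))) /\
  (forall t a b (B : set R), (0 < t)%N -> measurable B ->
      prob (sample_event t a b B) = prob (sample_event 1 a b B)).

(* marginal law: s_t ~ mu, s'_t ~ P(.|s_t), r_t in [0,1], E[r_t | s_t] = r(s_t) *)
Definition sample_law (Pk : S -> S -> R) (mu : S -> R) (r : S -> R) : Prop :=
  (forall t a, (0 < t)%N -> prob [set w | s t w = a] = mu a) /\
  (forall t a b, (0 < t)%N -> prob [set w | s t w = a /\ s' t w = b] = mu a * Pk a b) /\
  (forall t w, (0 < t)%N -> 0 <= rw t w <= 1) /\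
  (forall t a, (0 < t)%N ->
      (\int[P]_w (rw t w * (s t w == a)%:R)%:E = (r a * mu a)%:E)%E).

End Prob.

(* Main.v *)
(** Write [Delta_t = theta_t - theta^*] and [M = 2 |theta^*| + 1], so that the
    noise of one TD step is at most [2 |Delta| + M].  Take [eta0] of order
    [sqrt ((2 alpha - 1) / log (9 / delta))]: the squares of all the step sizes
    then sum to [O (1 / log (9 / delta))].

    Stage 1 (valid for all times at once, whence no [log T] loss): with
    [W_t = |Delta_t|^2 + M^2] and [p = log (9 / delta)], the mean TD step
    points towards [theta^*] and Hoeffding's lemma makes [W_t^p exp (- 264 p^2 sum eta^2)] a
    supermartingale; Ville's inequality keeps [W_t] below a constant times [W_0]
    except with probability [delta / 9].

    Stage 2: on that event the noise is bounded by a multiple of [M], and with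
    [rate_t] of order [kappa / (M^2 eta_t)], [kappa = (1 - gamma) lambda0], the
    moment [E exp (rate_t |Delta_t|^2)] stays below its value at the burn-in time
    [t0 = ((1 - gamma) lambda0 eta0 / (4 alpha))^(- 1 / (1 - alpha))], the time from
    which [eta_t] varies more slowly than the contraction.  Markov's inequality and
    a union bound over [t <= T] give [|Delta_t|^2 <~ M^2 log (T / delta) (t0 / t)^alpha],
    up to the factor [eta0^2 / (2 alpha - 1)].

    The reward enters one step affinely, so after the inequality
    [e^z <= z + e^(2 z^2)] the one-step expectations only involve the mean reward
    on each pair of states. *)

Require Import Defs.
From HB Require Import structures.
From mathcomp Require Import all_boot all_order all_algebra.
From mathcomp Require Import all_classical all_reals all_analysis.
From mathcomp Require Import measurable_realfun.
From mathcomp Require Import ring lra.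
Import Order.TTheory GRing.Theory Num.Theory.
Import numFieldNormedType.Exports.
Local Open Scope classical_set_scope.
Local Open Scope ring_scope.

(** * Euclidean inner product and the Cauchy-Schwarz inequality *)

Section inner_product.
Context {R : realType} {d : nat}.
Implicit Types u v x y : 'cV[R]_d.

Definition dot u v : R := (u^T *m v) 0 0.

Lemma dotE u v : dot u v = \sum_i u i 0 * v i 0.
Proof. by rewrite /dot mxE; apply: eq_bigr => i _; rewrite mxE. Qed.

Lemma dotC u v : dot u v = dot v u.
Proof. by rewrite !dotE; apply: eq_bigr => i _; rewrite mulrC. Qed.

Lemma dotDr u v x : dot u (v + x) = dot u v + dot u x.
Proof. by rewrite /dot mulmxDr mxE. Qed.

Lemma dotZr c u v : dot u (c *: v) = c * dot u v.
Proof. by rewrite /dot -scalemxAr mxE. Qed.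

Lemma dotNr u v : dot u (- v) = - dot u v.
Proof. by rewrite /dot mulmxN mxE. Qed.

Lemma dotDl u v x : dot (v + x) u = dot v u + dot x u.
Proof. by rewrite dotC dotDr !(dotC u). Qed.

Lemma dotZl c u v : dot (c *: v) u = c * dot v u.
Proof. by rewrite dotC dotZr dotC. Qed.

Lemma dotNl u v : dot (- v) u = - dot v u.
Proof. by rewrite dotC dotNr dotC. Qed.

Lemma dot0r u : dot u 0 = 0.
Proof. by rewrite /dot mulmx0 mxE. Qed.

Lemma dot_sumr (I : Type) (r : seq I) (P : pred I) (F : I -> 'cV[R]_d) u :
  dot u (\sum_(i <- r | P i) F i) = \sum_(i <- r | P i) dot u (F i).
Proof. by rewrite /dot mulmx_sumr summxE. Qed.

Lemma dot_rank1 u v x y : dot x ((u *m v^T) *m y) = dot x u * dot v y.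
Proof.
rewrite /dot -mulmxA mulmxA [x^T *m u]mx11_scalar [v^T *m y]mx11_scalar.
by rewrite mul_scalar_mx !mxE mulr1n.
Qed.

Lemma rank1_mul u v y : (u *m v^T) *m y = dot v y *: u.
Proof.
by rewrite -mulmxA [v^T *m y]mx11_scalar mul_mx_scalar.
Qed.

Lemma dot_ge0 u : 0 <= dot u u.
Proof. by rewrite dotE sumr_ge0// => i _; rewrite -expr2 sqr_ge0. Qed.

Lemma dot_eq0 u : (dot u u == 0) = (u == 0).
Proof.
apply/eqP/eqP => [|->]; last by rewrite dot0r.
rewrite dotE => /eqP; rewrite psumr_eq0; last by move=> i _; rewrite -expr2 sqr_ge0.
move=> /allP h; apply/matrixP => i j; rewrite ord1 mxE.
by have := h i (mem_index_enum _); rewrite -expr2 sqrf_eq0 => /eqP.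
Qed.

Lemma norm2E u : norm2 u = Num.sqrt (dot u u).
Proof. by rewrite /norm2 dotE; congr Num.sqrt; apply: eq_bigr => i _; rewrite expr2. Qed.

Lemma norm2_ge0 u : 0 <= norm2 u.
Proof. by rewrite norm2E sqrtr_ge0. Qed.

Lemma norm2_sqr u : norm2 u ^+ 2 = dot u u.
Proof. by rewrite norm2E sqr_sqrtr// dot_ge0. Qed.

Lemma norm2_dot_le u (c : R) : 0 <= c -> dot u u <= c ^+ 2 -> norm2 u <= c.
Proof. by move=> c0 h; rewrite norm2E -(ger0_norm c0) -sqrtr_sqr ler_wsqrtr. Qed.

Lemma cauchy_schwarz u v : `|dot u v| <= norm2 u * norm2 v.
Proof.
have nn := mulr_ge0 (norm2_ge0 u) (norm2_ge0 v).
rewrite -(ger0_norm nn) -ler_sqr ?nnegrE ?normr_ge0// !real_normK ?num_real//.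
rewrite exprMn !norm2_sqr.
have [->|v0] := eqVneq v 0; first by rewrite !dot0r mulr0 expr0n.
have vv : 0 < dot v v by rewrite lt_def dot_ge0 dot_eq0 v0.
have := dot_ge0 (dot v v *: u - dot u v *: v).
rewrite dotDr !dotDl !dotNl !dotNr !dotZl !dotZr (dotC v u) opprK.
have -> : dot v v * (dot v v * dot u u) - dot u v * (dot v v * dot u v)
   + (- (dot v v * (dot u v * dot u v)) + dot u v * (dot u v * dot v v))
   = dot v v * (dot u u * dot v v - dot u v ^+ 2) by ring.
by rewrite pmulr_rge0// subr_ge0.
Qed.

End inner_product.

(** * The smallest eigenvalue of a symmetric matrix as the minimum of its quadratic form *)

Lemma quad_ge0_eq0 {R : realFieldType} {a k : R} : 0 <= a -> 0 <= k ->
  (forall e, 0 <= - 2 * e * a + e ^+ 2 * k) -> a = 0.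
Proof.
(* The minimiser of the quadratic would be [a / k]; dividing by [k + 1] also covers [k = 0] and
   still gives a negative value unless [a = 0]. *)
move=> a0 k0 /(_ (a / (k + 1))).
have -> : - 2 * (a / (k + 1)) * a + (a / (k + 1)) ^+ 2 * k
   = - (a ^+ 2 * (k + 2)) / (k + 1) ^+ 2 by field; lra.
rewrite mulNr oppr_ge0 ler_pdivrMr ?mul0r ?exprn_gt0; [|lra..].
rewrite pmulr_lle0; last lra.
by rewrite real_exprn_even_le0 ?num_real //= => /eqP ->.
Qed.

Section rayleigh.
Context {R : realType} {d : nat}.

(** Row vectors are used because [bounded_closed_compact], the Heine-Borel theorem, speaks of
    rows. *)
Lemma compact_unit_sphere : compact [set x : 'rV[R]_d | dot x^T x^T = 1].
Proof.
apply: bounded_closed_compact.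
  exists 1; split; first exact: num_real.
  move=> M M1 x /= x1; rewrite [leLHS]/Num.norm /= mx_normrE; apply/bigmax_leP; split => [|[i j] _ /=].
    by rewrite ltW// (lt_trans _ M1).
  rewrite ord1 (le_trans _ (ltW M1))// -(@ler_pXn2r _ 2)// ?nnegrE//.
  rewrite expr1n real_normK ?num_real// -x1 dotE (bigD1 j)//= !mxE -expr2 lerDl.
  by rewrite sumr_ge0// => k _; rewrite -expr2 sqr_ge0.
have -> : [set x : 'rV[R]_d | dot x^T x^T = 1] =
   (fun x : 'rV[R]_d => \sum_i x 0 i * x 0 i) @^-1` [set 1].
  apply/seteqP; split => x /=; rewrite dotE => <-; 
  by apply: eq_bigr => i _; rewrite !mxE.
apply: closed_comp; last exact: closed_eq.
move=> x _; apply: continuous_big => [|i _]; first exact: add_continuous.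
by move=> {}x; apply: continuousM; exact: coord_continuous.
Qed.

(** By compactness the quadratic form attains a minimum [m] on the unit sphere. A minimiser is an
    eigenvector for [m], so [lam <= m], and homogeneity carries the bound from the sphere to all
    vectors. *)
Lemma lambda_min_rayleigh (M : 'M[R]_d) (lam : R) (x : 'cV[R]_d) : M^T = M ->
  is_lambda_min M lam -> lam * dot x x <= dot x (M *m x).
Proof.
move=> Msym [lam_eig lam_min].
have [->|x0] := eqVneq x 0; first by rewrite dot0r mulmx0 dot0r mulr0.
pose q (y : 'rV[R]_d) := dot y^T (M *m y^T).
have qE y : q y = \sum_i y 0 i * (\sum_j M i j * y 0 j).
  rewrite /q dotE; apply: eq_bigr => i _; rewrite !mxE; congr (_ * _).
  by apply: eq_bigr => j _; rewrite mxE.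
have xx : 0 < dot x x by rewrite lt_def dot_ge0 dot_eq0 x0.
pose nrm (y : 'cV[R]_d) := (Num.sqrt (dot y y))^-1 *: y.
have nrm1 y : 0 < dot y y -> dot (nrm y) (nrm y) = 1.
  move=> yy; rewrite dotZl dotZr mulrA -invfM -expr2 sqr_sqrtr ?mulVf ?gt_eqF//.
  exact: ltW.
have [||c] := @compact_EVT_min _ R q [set x : 'rV[R]_d | dot x^T x^T = 1] _
    compact_unit_sphere.
- by exists (nrm x)^T; rewrite /= trmxK nrm1.
- apply: continuous_subspaceT.
  have -> : q = fun y => \sum_i y 0 i * (\sum_j M i j * y 0 j) by apply/funext.
  apply: continuous_big => [|i _]; first exact: add_continuous.
  move=> y; apply: continuousM; first exact: coord_continuous.
  move: y; apply: continuous_big => [|j _]; first exact: add_continuous.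
  by move=> y; apply: continuousM; [exact: cst_continuous|exact: coord_continuous].
rewrite inE /= => cc cmin.
set m := q c in cmin.
have mle y : m * dot y y <= dot y (M *m y).
  have [->|y0] := eqVneq y 0; first by rewrite dot0r mulmx0 dot0r mulr0.
  have yy : 0 < dot y y by rewrite lt_def dot_ge0 dot_eq0 y0.
  have := cmin (nrm y)^T; rewrite inE /= trmxK nrm1// => /(_ erefl).
  rewrite /q trmxK -scalemxAr dotZl dotZr mulrA -invfM -expr2 sqr_sqrtr ?dot_ge0//.
  by rewrite mulrC ler_pdivlMr.
have dotM u v : dot u (M *m v) = dot v (M *m u).
  by rewrite dotC /dot trmx_mul Msym mulmxA.
(* first-order optimality: the nonnegative form y |-> <y,My> - m <y,y> vanishes at c *)
have opt : M *m c^T = m *: c^T.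
  apply/eqP; rewrite -subr_eq0 -dot_eq0; set g := _ - _.
  have gE : dot g (M *m c^T) - m * dot g c^T = dot g g.
    by rewrite {3}/g dotDr dotNr dotZr.
  clearbody g.
  pose k := dot g (M *m g) - m * dot g g.
  have k0 : 0 <= k by rewrite subr_ge0 mle.
  have H e : 0 <= - 2 * e * dot g g + e ^+ 2 * k.
    have := mle (c^T - e *: g).
    rewrite mulmxDr mulmxN -scalemxAr !(dotDl, dotDr, dotNl, dotNr, dotZl, dotZr).
    rewrite -subr_ge0 (dotM c^T g) -/(q c) -/m cc  (dotC c^T g).
    move/eqP: gE; rewrite subr_eq => /eqP -> h.
    by rewrite /k; lra.
  have gg0 := dot_ge0 g.
  by apply/eqP; exact: quad_ge0_eq0 gg0 k0 H.
have em : eigenvalue M m.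
  apply/eigenvalueP; exists c.
    (* [eigenvalue] refers to row vectors multiplied on the left, so symmetry is used to transpose
       [opt]. *)
    by rewrite -[in LHS]Msym -[c in LHS]trmxK -trmx_mul opt linearZ /= trmxK.
  by apply: contra_eq_neq cc => ->; rewrite trmx0 dot0r eq_sym oner_eq0.
by apply: le_trans (mle x); rewrite ler_wpM2r ?dot_ge0 ?lam_min.
Qed.

End rayleigh.

(** * Scalar inequalities for the exponential *)

Section exponential_moment.
Context {R : realType}.

(** A pointwise substitute for Hoeffding's lemma: for centred [z] the linear term vanishes in the
    mean and a sub-Gaussian factor remains. For [z >= 1/2] already [z <= 2 z^2]; below,
    [e^z <= 1 / (1 - z) <= 1 + z + 2 z^2]. *)
Lemma expR_le_sqr (z : R) : expR z <= z + expR (2 * z ^+ 2).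
Proof.
have sq := sqr_ge0 z.
have [z12|z12] := leP (2^-1) z.
  have : expR z <= expR (2 * z ^+ 2) by rewrite ler_expR; nra.
  by lra.
have e1 : 1 + 2 * z ^+ 2 <= expR (2 * z ^+ 2) by exact: expR_ge1Dx.
have e2 : expR z * (1 - z) <= 1.
  rewrite -[leRHS](expRxMexpNx_1 z) ler_wpM2l ?expR_ge0//.
  exact: expR_ge1Dx.
have e3 : expR z <= (1 - z)^-1 by rewrite -[leRHS]mul1r ler_pdivlMr //; lra.
have e4 : (1 - z)^-1 <= 1 + z + 2 * z ^+ 2.
  rewrite -[leLHS]mul1r ler_pdivrMr; last lra.
  have : 0 <= z ^+ 2 * (1 - 2 * z) by apply: mulr_ge0 => //; lra.
  by rewrite -subr_ge0; lra.
lra.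
Qed.

(** The previous bound recentred at [m]. For fixed [m] and [v] the right side is affine in [z], so
    its expectation requires only the mean of [z]. *)
Lemma expR_le_affine_sqr (z m v : R) : 2 * (z - m) ^+ 2 <= v ->
  expR z <= expR m * (z - m + expR v).
Proof.
move=> zv; rewrite -[in leLHS](subrK m z) addrC expRD ler_wpM2l ?expR_ge0//.
by rewrite (le_trans (expR_le_sqr _))// lerD2l ler_expR.
Qed.

(** The graph lies above its tangent at the weighted mean [m]; averaging the two tangent bounds
    cancels the linear terms. *)
Lemma expR_conv (p x y : R) : 0 <= p <= 1 ->
  expR ((1 - p) * x + p * y) <= (1 - p) * expR x + p * expR y.
Proof.
move=> /andP[p0 p1]; set m := _ + _.
have tangent z : expR m * (1 + (z - m)) <= expR z.
  rewrite [leRHS](_ : _ = expR m * expR (z - m)); last by rewrite -expRD addrC subrK.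
  by rewrite ler_wpM2l ?expR_ge0 ?expR_ge1Dx.
have q0 : 0 <= 1 - p by lra.
have := lerD (ler_wpM2l q0 (tangent x)) (ler_wpM2l p0 (tangent y)).
rewrite [leLHS](_ : _ = expR m * (1 + ((1 - p) * x + p * y - m))); last by ring.
by rewrite subrr addr0 mulr1.
Qed.

End exponential_moment.

(** * One TD step from a fixed iterate: coercivity of the mean step and its exponential bound *)

Section mean_path.
Context {R : realType} {S : finType} {d : nat} {gamma : R}.
Context {Pk : S -> S -> R} {mu r : S -> R} {phi : S -> 'cV[R]_d} {lambda0 : R}.
Hypothesis gamma01 : 0 <= gamma < 1.
Hypothesis kernelP : is_kernel Pk.
Hypothesis muP : is_stationary Pk mu.
Hypothesis phi1 : forall a, norm2 (phi a) <= 1.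
Hypothesis lambda0P : is_lambda_min (TD_Sigma mu phi) lambda0.
Hypothesis lambda0_gt0 : 0 < lambda0.

Local Notation A := (TD_A gamma Pk mu phi).
Local Notation thstar := (theta_star gamma Pk mu r phi).

Let mu0 a : 0 <= mu a. Proof. by case: muP => -[]. Qed.
Let Pk0 a b : 0 <= Pk a b. Proof. by case: kernelP. Qed.
Let Pk1 a : \sum_b Pk a b = 1. Proof. by case: kernelP. Qed.
Let mu1 : \sum_a mu a = 1. Proof. by case: muP => -[]. Qed.
Let muPk b : \sum_a mu a * Pk a b = mu b. Proof. by case: muP. Qed.

Lemma dot_Sigma x : dot x (TD_Sigma mu phi *m x) = \sum_a mu a * dot (phi a) x ^+ 2.
Proof.
rewrite /TD_Sigma mulmx_suml dot_sumr; apply: eq_bigr => a _.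
by rewrite -scalemxAl dotZr dot_rank1 expr2 (dotC x).
Qed.

Lemma Sigma_lower_bound x : lambda0 * dot x x <= \sum_a mu a * dot (phi a) x ^+ 2.
Proof.
rewrite -dot_Sigma; apply: lambda_min_rayleigh => //.
rewrite /TD_Sigma linear_sum; apply: eq_bigr => a _ /=.
by rewrite linearZ /= trmx_mul trmxK.
Qed.

Lemma dot_phi_le a x : dot (phi a) x ^+ 2 <= dot x x.
Proof.
rewrite -norm2_sqr -real_normK ?num_real// ler_sqr ?nnegrE ?norm2_ge0//.
by rewrite (le_trans (cauchy_schwarz _ _))// ler_piMl ?norm2_ge0.
Qed.

(** An eigenvector supplies a nonzero vector, and on it features of norm at most 1 bound the
    quadratic form. This makes [(1 - gamma) * lambda0] at most 1, as the step-size estimates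
    require. *)
Lemma lambda0_le1 : lambda0 <= 1.
Proof.
have [/eigenvalueP[v _ v0] _] := lambda0P.
have vv : 0 < dot v^T v^T.
  by rewrite lt_def dot_ge0 dot_eq0 -(trmx0 _ _ _) (inj_eq trmx_inj) v0.
rewrite -(ler_pM2r vv) mul1r (le_trans (Sigma_lower_bound _))//.
rewrite -[leRHS]mul1r -mu1 mulr_suml ler_sum// => a _.
by rewrite ler_wpM2l// dot_phi_le.
Qed.

Lemma dot_TD_A x y : dot x (A *m y) =
  \sum_a \sum_b mu a * Pk a b * (dot (phi a) x * dot (phi a - gamma *: phi b) y).
Proof.
rewrite /TD_A mulmx_suml dot_sumr; apply: eq_bigr => a _.
rewrite mulmx_suml dot_sumr; apply: eq_bigr => b _.
by rewrite -scalemxAl dotZr dot_rank1 (dotC x).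
Qed.

(* AM-GM on the cross term; stationarity identifies the two second moments. *)
Lemma TD_A_coercive x : (1 - gamma) * lambda0 * dot x x <= dot x (A *m x).
Proof.
case/andP: gamma01 => g0 g1.
rewrite -mulrA (le_trans (ler_wpM2l _ (Sigma_lower_bound x))) ?subr_ge0 ?(ltW g1)//.
set E := \sum_a _.
have E1 : \sum_a \sum_b mu a * Pk a b * dot (phi a) x ^+ 2 = E.
  apply: eq_bigr => a _; rewrite -mulr_suml; congr (_ * _).
  by rewrite -mulr_sumr Pk1 mulr1.
have E2 : \sum_a \sum_b mu a * Pk a b * dot (phi b) x ^+ 2 = E.
  by rewrite exchange_big; apply: eq_bigr => b _; rewrite -mulr_suml muPk.
have -> : (1 - gamma) * E = E - gamma / 2 * (E + E) by field.
rewrite -{1}E1 -{1}E1 -{1}E2 -big_split mulr_sumr -sumrB dot_TD_A ler_sum//= => a _.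
rewrite -big_split mulr_sumr -sumrB ler_sum//= => b _.
have w0 := mulr_ge0 (mu0 a) (Pk0 a b).
rewrite dotDl dotNl dotZl.
have := mulr_ge0 w0 (mulr_ge0 g0 (sqr_ge0 (dot (phi a) x - dot (phi b) x))).
by lra.
Qed.

(** Coercivity leaves no nonzero vector in the kernel. On a singular matrix [invmx] returns its
    argument, so this is what makes [theta_star] solve the linear system. *)
Lemma TD_A_unit : A \in unitmx.
Proof.
rewrite unitmxE unitfE; apply/negP => /det0P[v v0 vA].
have Av : dot v^T (A *m v^T) = 0 by rewrite /dot trmxK mulmxA vA mul0mx mxE.
have := TD_A_coercive v^T; rewrite Av.
have vv : 0 < dot v^T v^T.
  by rewrite lt_def dot_ge0 dot_eq0 -(trmx0 _ _ _) (inj_eq trmx_inj) v0.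
by case/andP: gamma01 => _ g1; rewrite leNgt !mulr_gt0 ?subr_gt0.
Qed.

Lemma TD_A_theta_star : A *m thstar = TD_b mu r phi.
Proof. by rewrite /theta_star mulKVmx// TD_A_unit. Qed.

Lemma norm_dot_phi_le a x : `|dot (phi a) x| <= norm2 x.
Proof. by rewrite (le_trans (cauchy_schwarz _ _))// ler_piMl ?norm2_ge0. Qed.

(** The usual temporal-difference error with its sign reversed. *)
Definition td_error (th : 'cV[R]_d) (a b : S) (y : R) : R :=
  dot (phi a - gamma *: phi b) th - y.

Definition td_step (eta : R) (th : 'cV[R]_d) (a b : S) (y : R) : 'cV[R]_d :=
  th - eta *: ((phi a *m (phi a - gamma *: phi b)^T) *m th - y *: phi a).

Local Notation M := (2 * norm2 thstar + 1).
Definition sqerr (th : 'cV[R]_d) : R := dot (th - thstar) (th - thstar).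

Lemma sqerr_ge0 th : 0 <= sqerr th. Proof. exact: dot_ge0. Qed.

Lemma td_error_le th a b y : 0 <= y <= 1 ->
  `|td_error th a b y| <= 2 * norm2 (th - thstar) + M.
Proof.
case/andP: gamma01 => g0 g1 /andP[y0 y1]; rewrite /td_error.
have -> : dot (phi a - gamma *: phi b) th = dot (phi a) (th - thstar)
   - gamma * dot (phi b) (th - thstar) + dot (phi a) thstar - gamma * dot (phi b) thstar.
  rewrite dotDl dotNl dotZl !dotDr !dotNr; ring.
have gx c v : `|gamma * dot (phi c) v| <= norm2 v.
  by rewrite normrM ger0_norm// (le_trans _ (norm_dot_phi_le c v))// ler_piMl// ltW.
have y1' : `|y| <= 1 by rewrite ger0_norm.
have := norm_dot_phi_le a (th - thstar); have := norm_dot_phi_le a thstar.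
have := gx b (th - thstar); have := gx b thstar.
move: y1'; rewrite !ler_norml => *; lra.
Qed.

Lemma norm2_thstar_ge0 : 0 <= norm2 thstar. Proof. exact: norm2_ge0. Qed.

(** The inequality [4 x M <= 4 x^2 + M^2] removes the cross term. A common factor 8 lets the single
    quantity [sqerr th + M ^+ 2] control the noise from here on. *)
Lemma td_error_sqr_le th a b y : 0 <= y <= 1 ->
  td_error th a b y ^+ 2 <= 8 * (sqerr th + M ^+ 2).
Proof.
move=> y01; have e := td_error_le th a b y y01.
have t0 := norm2_thstar_ge0; have n0 := norm2_ge0 (th - thstar).
rewrite -real_normK ?num_real// (@le_trans _ _ ((2 * norm2 (th - thstar) + M) ^+ 2))//.
  by rewrite ler_sqr ?nnegrE//; lra.
rewrite /sqerr -norm2_sqr; set x := norm2 _; set z := M.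
by have := sqr_ge0 (2 * x - z); have := sqr_ge0 z; lra.
Qed.

(** Only the term quadratic in [eta] is estimated; the first-order term is kept exact because its
    mean is the drift towards [thstar]. *)
Lemma sqerr_td_step eta th a b y : 0 <= y <= 1 ->
  sqerr (td_step eta th a b y) - sqerr th <=
    - 2 * eta * (dot (phi a) (th - thstar) * td_error th a b y)
    + eta ^+ 2 * (8 * (sqerr th + M ^+ 2)).
Proof.
move=> y01; have := td_error_sqr_le th a b y y01; set Q := 8 * _ => dQ.
rewrite /sqerr /td_step rank1_mul -scalerBl -/(td_error th a b y) scalerA.
set D := td_error _ _ _ _ in dQ *; rewrite addrAC.
move: (th - thstar) => v; rewrite !(dotDl, dotDr, dotNl, dotNr, dotZl, dotZr) (dotC v).
have p1 : dot (phi a) (phi a) <= 1.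
  by rewrite -norm2_sqr expr_le1 ?norm2_ge0.
have : eta ^+ 2 * (D ^+ 2 * dot (phi a) (phi a)) <= eta ^+ 2 * Q.
  rewrite ler_wpM2l ?sqr_ge0// (le_trans _ dQ)// ler_piMr ?sqr_ge0//.
rewrite -subr_ge0 => h; rewrite -subr_ge0; move: h; congr (_ <= _); ring.
Qed.

Lemma norm_dot_TD_A_le x : `|dot x (A *m x)| <= 2 * dot x x.
Proof.
case/andP: gamma01 => g0 g1.
rewrite dot_TD_A (le_trans (ler_norm_sum _ _ _))//.
rewrite [leRHS](_ : _ = (\sum_a mu a) * (2 * dot x x)); last by rewrite mu1 mul1r.
rewrite mulr_suml ler_sum// => a _.
rewrite (le_trans (ler_norm_sum _ _ _))//.
rewrite [mu a * _](_ : _ = mu a * (\sum_b Pk a b) * (2 * dot x x)); last by rewrite Pk1 mulr1.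
rewrite mulr_sumr mulr_suml ler_sum// => b _.
have w0 := mulr_ge0 (mu0 a) (Pk0 a b).
rewrite normrM ger0_norm// ler_wpM2l// dotDl dotNl dotZl.
have := dot_phi_le a x; have := dot_phi_le b x.
set u := dot (phi a) x; set v := dot (phi b) x => hv hu.
have uv : `|u * v| <= dot x x.
  by rewrite ler_norml; have := sqr_ge0 (u - v); have := sqr_ge0 (u + v); lra.
have guv : `|gamma * (u * v)| <= dot x x.
  by rewrite normrM ger0_norm// (le_trans _ uv)// ler_piMl// ltW.
have := sqr_ge0 u; move: guv; rewrite !ler_norml => /andP[? ?] ?.
by apply/andP; split; lra.
Qed.

(** Mean over the sample of [c] times the first-order term in [sqerr_td_step]. *)
Definition td_drift (c eta : R) (th : 'cV[R]_d) : R :=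
  - 2 * c * eta * dot (th - thstar) (A *m (th - thstar)).

(** Bound on twice the squared deviation of the exponent from [td_drift]: the factor [-2 c eta]
    contributes 8 and the deviation itself 32, whence 256. *)
Definition td_vproxy (c eta : R) (th : 'cV[R]_d) : R :=
  256 * (c ^+ 2 * eta ^+ 2 * (sqerr th * (sqerr th + M ^+ 2))).

(** The bracket of [expR_le_affine_sqr] for one step, with [expR (td_drift c eta th)] factored out.
    It is affine in the reward [y]. *)
Definition td_kernel (c eta : R) (th : 'cV[R]_d) (a b : S) (y : R) : R :=
  - 2 * c * eta * (dot (phi a) (th - thstar) * td_error th a b y)
  - td_drift c eta th + expR (td_vproxy c eta th).

Lemma td_kernel_affine c eta th a b y : td_kernel c eta th a b y =
  (1 - y) * td_kernel c eta th a b 0 + y * td_kernel c eta th a b 1.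
Proof. rewrite /td_kernel /td_error; ring. Qed.

Lemma expR_td_kernel c eta th a b y : 0 <= c -> 0 <= eta -> 0 <= y <= 1 ->
  expR (- 2 * c * eta * (dot (phi a) (th - thstar) * td_error th a b y)) <=
  expR (td_drift c eta th) * td_kernel c eta th a b y.
Proof.
move=> c0 e0 y01; apply: expR_le_affine_sqr.
rewrite /td_drift /td_vproxy; set u := dot (phi a) _ * _; set m := dot _ (_ *m _).
have n0 := norm2_ge0 (th - thstar); have t0 := norm2_thstar_ge0.
have G0 : 0 <= 2 * norm2 (th - thstar) + M by lra.
have uB : `|u| <= norm2 (th - thstar) * (2 * norm2 (th - thstar) + M).
  by rewrite normrM ler_pM ?norm_dot_phi_le ?td_error_le.
have mB : `|m| <= norm2 (th - thstar) * (2 * norm2 (th - thstar) + M).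
  rewrite (le_trans (norm_dot_TD_A_le _))// -norm2_sqr expr2 mulrCA ler_wpM2l//.
  lra.
have umB : (u - m) ^+ 2 <=
    4 * (norm2 (th - thstar) ^+ 2 * (2 * norm2 (th - thstar) + M) ^+ 2).
  rewrite -exprMn; set q := _ * (_ + M) in uB mB *.
  have -> : 4 * q ^+ 2 = (2 * q) ^+ 2 by ring.
  have q0 : 0 <= q by rewrite mulr_ge0.
  rewrite -real_normK ?num_real// ler_sqr ?nnegrE ?normr_ge0//; last lra.
  by move: uB mB; rewrite !ler_norml => *; lra.
have GB : (2 * norm2 (th - thstar) + M) ^+ 2 <= 8 * (sqerr th + M ^+ 2).
  rewrite /sqerr -norm2_sqr; set x := norm2 _; set z := M.
  by have := sqr_ge0 (2 * x - z); have := sqr_ge0 z; lra.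
have YG : norm2 (th - thstar) ^+ 2 * (2 * norm2 (th - thstar) + M) ^+ 2 <=
    sqerr th * (8 * (sqerr th + M ^+ 2)).
  by rewrite -/(sqerr th) norm2_sqr -/(sqerr th) ler_wpM2l// sqerr_ge0.
have um2 : (u - m) ^+ 2 <= 32 * (sqerr th * (sqerr th + M ^+ 2)) by lra.
have := ler_wpM2l (sqr_ge0 (c * eta)) um2.
by lra.
Qed.

(** Times a positive factor it dominates an exponential. Nonnegativity permits the later integrals
    to be split without integrability conditions. *)
Lemma td_kernel_ge0 c eta th a b y : 0 <= c -> 0 <= eta -> 0 <= y <= 1 ->
  0 <= td_kernel c eta th a b y.
Proof.
move=> c0 e0 y01; have := expR_td_kernel c eta th a b y c0 e0 y01.
move=> /(le_trans (expR_ge0 _)); by rewrite pmulr_rge0// expR_gt0.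
Qed.

(** Affinity in [y] is spelled out as an interpolation between rewards 0 and 1, the shape in which
    the reward is later integrated out. *)
Lemma expR_sqerr_td_step c eta th a b y : 0 <= c -> 0 <= eta -> 0 <= y <= 1 ->
  expR (c * (sqerr (td_step eta th a b y) - sqerr th)) <=
  expR (8 * (c * eta ^+ 2 * (sqerr th + M ^+ 2)) + td_drift c eta th)
    * ((1 - y) * td_kernel c eta th a b 0 + y * td_kernel c eta th a b 1).
Proof.
move=> c0 e0 y01; rewrite -td_kernel_affine expRD -mulrA.
apply: le_trans (ler_wpM2l (expR_ge0 _) (expR_td_kernel c eta th a b y c0 e0 y01)).
rewrite -expRD ler_expR.
have := ler_wpM2l c0 (sqerr_td_step eta th a b y y01).
by lra.
Qed.

(** Here [q a b] stands for the mean of the reward on the event that the pair of states is [(a, b)].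
    Only its sums over [b] are prescribed; they suffice because the reward multiplies
    [dot (phi a) (th - thstar)], which does not involve [b]. *)
Lemma mean_td_kernel c eta th (q : S -> S -> R) :
  (forall a, \sum_b q a b = mu a * r a) ->
  \sum_a \sum_b ((mu a * Pk a b - q a b) * td_kernel c eta th a b 0
                 + q a b * td_kernel c eta th a b 1) = expR (td_vproxy c eta th).
Proof.
move=> qr.
(* Since [A *m thstar] is [TD_b mu r phi], the drift is the mean of the first-order term. *)
have drift : dot (th - thstar) (A *m (th - thstar)) =
    \sum_a \sum_b (mu a * Pk a b *
       (dot (phi a) (th - thstar) * dot (phi a - gamma *: phi b) th)
       - q a b * dot (phi a) (th - thstar)).
  rewrite mulmxBr TD_A_theta_star dotDr dotNr dot_TD_A /TD_b dot_sumr -sumrB.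
  apply: eq_bigr => a _; rewrite sumrB -mulr_suml qr dotZr (dotC (th - thstar)).
  by [].
transitivity (\sum_a \sum_b (mu a * Pk a b * (expR (td_vproxy c eta th) - td_drift c eta th)
   + (- 2 * c * eta) * (mu a * Pk a b *
       (dot (phi a) (th - thstar) * dot (phi a - gamma *: phi b) th)
       - q a b * dot (phi a) (th - thstar)))).
  apply: eq_bigr => a _; apply: eq_bigr => b _.
  rewrite /td_kernel /td_error; ring.
under eq_bigr => a _ do rewrite big_split -mulr_suml -mulr_sumr Pk1 mulr1 -mulr_sumr.
rewrite big_split -mulr_suml mu1 mul1r -mulr_sumr -drift /= /td_drift; ring.
Qed.

Lemma td_drift_le c eta th : 0 <= c -> 0 <= eta ->
  td_drift c eta th <= - 2 * c * eta * ((1 - gamma) * lambda0 * sqerr th).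
Proof.
move=> c0 e0; have := ler_wpM2l (mulr_ge0 c0 e0) (TD_A_coercive (th - thstar)).
rewrite /td_drift /sqerr; lra.
Qed.

End mean_path.

(** * Expectation of a product of independent nonnegative variables *)

Section independent_product.
Context {R : realType} {dO : measure_display} {Omega : measurableType dO}.
Variable P : probability Omega R.

(** Independence on rectangles identifies the joint law with the product of the marginal laws;
    Tonelli's theorem then factors the integral. *)
Lemma ge0_integral_indep (X Y : Omega -> R) :
  measurable_fun setT X -> measurable_fun setT Y ->
  (forall w, 0 <= X w) -> (forall w, 0 <= Y w) ->
  (forall A B, measurable A -> measurable B ->
    P (X @^-1` A `&` Y @^-1` B) = (P (X @^-1` A) * P (Y @^-1` B))%E) ->
  (\int[P]_w (X w * Y w)%:E = \int[P]_w (X w)%:E * \int[P]_w (Y w)%:E)%E.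
Proof.
move=> mX mY X0 Y0 XY.
pose mXp : {mfun Omega >-> R} := HB.pack X (isMeasurableFun.Build _ _ _ _ _ mX).
pose mYp : {mfun Omega >-> R} := HB.pack Y (isMeasurableFun.Build _ _ _ _ _ mY).
have mXY : measurable_fun setT (fun w => (X w, Y w)) by exact: measurable_fun_pair.
pose mXYp : {mfun Omega >-> (R * R)%type} :=
  HB.pack (fun w => (X w, Y w)) (isMeasurableFun.Build _ _ _ _ _ mXY).
(* Absolute values make the integrand nonnegative on the whole plane without changing it on the
   values of [X] and [Y]. *)
pose f (z : (R * R)%type) : \bar R := (`|z.1| * `|z.2|)%:E.
have mf : measurable_fun [set: (R * R)%type] f.
  by apply/measurable_EFinP; apply: measurable_funM; apply: measurableT_comp.
have f0 z : (0 <= f z)%E by rewrite lee_fin mulr_ge0.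
transitivity (\int[distribution P mXYp]_z f z)%E.
  rewrite ge0_integral_distribution//; apply: eq_integral => w _.
  by rewrite /f /= !ger0_norm.
transitivity (\int[distribution P mXp \x distribution P mYp]_z f z)%E.
  apply: eq_measure_integral => A mA _; apply/esym.
  by apply: product_measure_unique => // B1 B2 mB1 mB2; exact: XY.
rewrite fubini_tonelli1//.
have mabs : measurable_fun setT (fun y : R => `|y|%:E) by apply: measurableT_comp.
have nrm (Z : {mfun Omega >-> R}) : (forall w, 0 <= Z w) ->
    (\int[distribution P Z]_y `|y|%:E = \int[P]_w (Z w)%:E)%E.
  move=> Z0; rewrite ge0_integral_distribution//=.
  by apply: eq_integral => w _ /=; rewrite ger0_norm.
transitivity (\int[distribution P mXp]_x (`|x|%:E * \int[P]_w (Y w)%:E))%E.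
  apply: eq_integral => x _; rewrite /fubini_F /f/=.
  under eq_integral do rewrite EFinM.
  by rewrite ge0_integralZl//= (nrm mYp).
rewrite ge0_integralZr//=; first by rewrite (nrm mXp).
by apply: integral_ge0 => w _; rewrite lee_fin.
Qed.

End independent_product.

(** * The filtration of the samples and independence of the next sample from the past *)

Section history.
Context {R : realType} {dO : measure_display} {Omega : measurableType dO}.
Context {P : probability Omega R} {S : finType}.
Context {s s' : nat -> Omega -> S} {rw : nat -> Omega -> R}.
Hypothesis samples_iid : iid_samples P s s' rw.

Local Notation event := (sample_event s s' rw).

Lemma measurable_sample_event t a b B : measurable B -> measurable (event t a b B).
Proof.
have [ms [ms' [mrw _]]] := samples_iid.
move=> mB; rewrite (_ : event t a b B = [set w | s t w = a] `&`
   ([set w | s' t w = b] `&` (rw t @^-1` B)))//.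
by apply: measurableI => //; apply: measurableI => //; rewrite -[X in measurable X]setTI; exact: mrw.
Qed.

(** A cylinder event. The predicate [J] selects the constrained times: fixed states [a i] and [b i]
    cannot express the absence of a constraint at time [i]. *)
Definition history_event t (J : pred nat) (a b : nat -> S) (B : nat -> set R) :=
  [set w | forall i, (0 < i <= t)%N -> J i -> event i (a i) (b i) (B i) w].

Lemma history_eventE t J a b B : history_event t J a b B =
  \big[setI/setT]_(i <- [seq i <- iota 1 t | J i]) event i (a i) (b i) (B i).
Proof.
rewrite -bigcap_seq; apply/seteqP; split => w /= h i.
  by rewrite /= mem_filter mem_iota add1n ltnS => /andP[Ji /h]; exact.
by move=> it Ji; apply: h; rewrite /= mem_filter mem_iota add1n ltnS it Ji.
Qed.

Definition history_gen t : set (set Omega) :=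
  [set E | exists J a b B, (forall i, measurable (B i)) /\ E = history_event t J a b B].

Lemma history_gen_measurable t : history_gen t `<=` measurable.
Proof.
move=> _ [J [a [b [B [mB ->]]]]]; rewrite history_eventE.
by elim/big_ind : _ => // [|i _]; [exact: measurableI|exact: measurable_sample_event].
Qed.

Lemma history_gen_setI_closed t : setI_closed (history_gen t).
Proof.
move=> _ _ [J1 [a1 [b1 [B1 [mB1 ->]]]]] [J2 [a2 [b2 [B2 [mB2 ->]]]]].
(* At a time constrained by both events, different prescribed states are incompatible; the empty
   reward set records this. *)
pose B i := if J1 i then (if J2 i then
    (if (a1 i == a2 i) && (b1 i == b2 i) then B1 i `&` B2 i else set0) else B1 i) else B2 i.
exists (predU J1 J2), (fun i => if J1 i then a1 i else a2 i),
  (fun i => if J1 i then b1 i else b2 i), B; split.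
  move=> i; rewrite /B; case: ifP => // _; case: ifP => // _; case: ifP => // _.
  exact: measurableI.
apply/seteqP; split => [w [h1 h2] i it|w h].
  rewrite /B /sample_event /=; case: ifPn => [j1 _|j1]; last first.
    by move=> /= j2; exact: h2 i it j2.
  case: ifPn => [j2|_]; last exact: h1 i it j1.
  have [e1 [e2 b1w]] := h1 i it j1; have [e3 [e4 b2w]] := h2 i it j2.
  by rewrite -e1 -e2 -e3 -e4 !eqxx.
split => i it j; have := h i it; rewrite /B /sample_event /= j ?orbT /= => /(_ isT).
  by case: ifPn => // j2; case: ifPn => [_|_] [? [? []]].
case: ifPn => // j1; case: ifPn => [/andP[/eqP <- /eqP <-]|_] [? [? []]] //.
Qed.

(** The product formula for lists of distinct times is applied to [t.+1] followed by the constrained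
    times, and again to the constrained times alone. [upd] prescribes the new sample at [t.+1]. *)
Lemma history_gen_indep t a b B E : measurable B -> history_gen t E ->
  (P (event t.+1 a b B `&` E) = P (event t.+1 a b B) * P E)%E.
Proof.
move=> mB hE; have /= mE := @history_gen_measurable t E hE.
have mX := measurable_sample_event t.+1 a b B mB.
have [_ [_ [_ [prodP _]]]] := samples_iid.
have [J [a1 [b1 [B1 [mB1 EE]]]]] := hE.
pose I := [seq i <- iota 1 t | J i].
have tI : t.+1 \notin I by rewrite mem_filter mem_iota add1n ltnn !andbF.
have uI : uniq I by rewrite filter_uniq// iota_uniq.
have pI : all (fun i => 0 < i)%N I.
  by apply/allP => i; rewrite mem_filter mem_iota => /and3P[].
pose upd T (f : nat -> T) (c : T) i := if i == t.+1 then c else f i.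
have := prodP (t.+1 :: I) (upd _ a1 a) (upd _ b1 b) (upd _ B1 B).
rewrite /= tI uI pI => /(_ isT isT).
have updI T (f : nat -> T) c i : i \in I -> upd T f c i = f i.
  by rewrite /upd; case: eqP => // ->; rewrite (negPf tI).
rewrite !big_cons (eq_big_seq (fun i => event i (a1 i) (b1 i) (B1 i))); last first.
  by move=> i iI; rewrite !updI.
rewrite [X in _ = _ * X](eq_big_seq (fun i => prob P (event i (a1 i) (b1 i) (B1 i)))); last first.
  by move=> i iI; rewrite !updI.
rewrite -prodP// -history_eventE -EE /upd eqxx => h.
have {}h : prob P (event t.+1 a b B `&` E) = prob P (event t.+1 a b B) * prob P E.
  by apply: h => i; case: ifP.
have : (prob P (event t.+1 a b B `&` E))%:E = (prob P (event t.+1 a b B) * prob P E)%:E.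
  by rewrite h.
rewrite /prob EFinM !fineK ?fin_num_measure//.
exact: measurableI.
Qed.

(** The filtration as a family of types: the space [Omega] with the sigma-algebra of the first [t]
    samples, so that being adapted is plain measurability on [history t]. *)
Definition history t := g_sigma_algebraType (history_gen t).

Lemma history_measurable t (E : set (history t)) : measurable E ->
  measurable (E : set Omega).
Proof.
by apply: smallest_sub; [exact: sigma_algebra_measurable|exact: history_gen_measurable].
Qed.

Lemma history_measurable_fun t (f : history t -> R) : measurable_fun setT f ->
  measurable_fun setT (f : Omega -> R).
Proof. by move=> mf _ B mB; apply: history_measurable; exact: mf. Qed.

(** Both sides are finite measures in [E] that agree on the cylinder events, which are closed under
    intersection and generate the sigma-algebra. *)
Lemma history_indep t a b B (E : set (history t)) : measurable B -> measurable E ->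
  (P (event t.+1 a b B `&` E) = P (event t.+1 a b B) * P E)%E.
Proof.
move=> mB mE; have mX := measurable_sample_event t.+1 a b B mB.
pose c : {nonneg R} := NngNum (fine_ge0 (measure_ge0 P (event t.+1 a b B))).
have -> : (P (event t.+1 a b B) * P E = mscale c P E)%E.
  by rewrite /mscale /= fineK// fin_num_measure.
rewrite setIC.
apply: (@g_sigma_algebra_measure_unique _ _ _ (history_gen t) _ (fun=> setT) _ _
  (mrestr P mX) (mscale c P)) mE.
- exact: history_gen_measurable.
(* With no constrained time the cylinder event is the whole space. *)
- move=> _; exists pred0, (fun i => s i point), (fun i => s i point), (fun=> set0).
  by split => //; apply/seteqP; split.
- by apply/seteqP; split => // w _; exists 0%N.
- exact: history_gen_setI_closed.
- move=> A hA; rewrite /= /mrestr setIC history_gen_indep// /mscale /=.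
  by rewrite fineK// fin_num_measure.
- by move=> k; rewrite /= /mrestr setTI ltey_eq fin_num_measure.
Qed.

End history.

(** * Functions of the past and of the next sample *)

Section history_step.
Context {R : realType} {dO : measure_display} {Omega : measurableType dO}.
Context {P : probability Omega R} {S : finType}.
Context {s s' : nat -> Omega -> S} {rw : nat -> Omega -> R}.
Hypothesis samples_iid : iid_samples P s s' rw.

Local Notation event := (sample_event s s' rw).
Local Notation history t := (@history R dO Omega S s s' rw t).

Lemma history_event_measurable t i a b B : (0 < i <= t)%N -> measurable B ->
  measurable (event i a b B : set (history t)).
Proof.
move=> it mB; apply: sub_sigma_algebra.
exists (pred1 i), (fun=> a), (fun=> b), (fun=> B); split => //.
apply/seteqP; split => [w h j _ /eqP -> //|w h].
by apply: (h i it); rewrite /= eqxx.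
Qed.

Lemma history_measurableS t (E : set (history t)) : measurable E ->
  measurable (E : set (history t.+1)).
Proof.
apply: sub_sigma_algebra2 => _ [J [a [b [B [mB ->]]]]].
(* Viewed at time [t.+1], the event puts no constraint on the last sample. *)
exists (fun i => J i && (i <= t)%N), a, b, B; split => //.
apply/seteqP; split => w h i.
  by move=> /andP[i0 _] /andP[Ji it]; refine (h i _ Ji); exact/andP.
move=> /andP[i0 it] Ji; refine (h i _ _); first by rewrite i0 leqW.
by rewrite Ji.
Qed.

Lemma history_measurable_funS t (f : history t -> R) : measurable_fun setT f ->
  measurable_fun setT (f : history t.+1 -> R).
Proof. by move=> mf _ B mB; apply: history_measurableS; exact: mf. Qed.

Definition sample_ind i a b (w : Omega) : R := ((s i w == a) && (s' i w == b))%:R.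

Lemma sample_ind_ge0 i a b w : 0 <= sample_ind i a b w.
Proof. by rewrite /sample_ind ler0n. Qed.

(** Partitioning by the pair of states turns evaluation at random states into a finite sum of
    products, to which measurability and independence apply term by term. *)
Lemma sample_indE i (f : S -> S -> R) w :
  f (s i w) (s' i w) = \sum_a \sum_b sample_ind i a b w * f a b.
Proof.
rewrite (bigD1 (s i w))//= (bigD1 (s' i w))//= /sample_ind !eqxx mul1r.
rewrite !big1 ?addr0//.
  move=> a aw; rewrite big1// => b _; rewrite (eq_sym _ a) (negPf aw) mul0r//.
by move=> b bw; rewrite (eq_sym _ b) (negPf bw) mul0r.
Qed.

Lemma sample_ind_measurable t i a b : (0 < i <= t)%N ->
  measurable_fun setT (sample_ind i a b : history t -> R).
Proof.
move=> it; rewrite (_ : sample_ind i a b = \1_(event i a b setT)).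
  by apply: measurable_indic; exact: history_event_measurable.
apply/funext => w; rewrite /sample_ind indicE; congr ((nat_of_bool _)%:R).
apply/idP/idP => [/andP[/eqP wa /eqP wb]|]; first by rewrite inE.
by rewrite inE /sample_event /= => -[-> [-> _]]; rewrite !eqxx.
Qed.

Lemma rw_measurable t i : (0 < i <= t)%N ->
  measurable_fun setT (rw i : history t -> R).
Proof.
move=> it _ B mB; rewrite setTI.
rewrite (_ : _ @^-1` B = \bigcup_(a in [set: S]) \bigcup_(b in [set: S]) event i a b B).
  apply: fin_bigcup_measurable => // a _; apply: fin_bigcup_measurable => // b _.
  exact: history_event_measurable.
apply/seteqP; split => w /=; first by move=> h; exists (s i w) => //; exists (s' i w).
by move=> [a _ [b _ [_ []]]].
Qed.

Lemma sample_fun_measurable t i (f : S -> S -> Omega -> R) : (0 < i <= t)%N ->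
  (forall a b, measurable_fun setT (f a b : history t -> R)) ->
  measurable_fun setT ((fun w => f (s i w) (s' i w) w) : history t -> R).
Proof.
move=> it mf.
rewrite (_ : (fun w => _) = fun w => \sum_a \sum_b sample_ind i a b w * f a b w); last first.
  by apply/funext => w; rewrite (sample_indE i (fun a b => f a b w)).
apply: measurable_sum => a; apply: measurable_sum => b.
by apply: measurable_funM => //; exact: sample_ind_measurable.
Qed.

Lemma ge0_integral_history t (X : Omega -> R) (psi : R -> R) a b :
  measurable_fun setT (X : history t -> R) -> (forall w, 0 <= X w) ->
  measurable_fun setT psi -> (forall w, 0 <= psi (rw t.+1 w)) ->
  (\int[P]_w (X w * (sample_ind t.+1 a b w * psi (rw t.+1 w)))%:E =
   \int[P]_w (X w)%:E * \int[P]_w (sample_ind t.+1 a b w * psi (rw t.+1 w))%:E)%E.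
Proof.
move=> mX X0 mpsi psi0; apply: ge0_integral_indep => //.
- exact: (history_measurable_fun samples_iid t X mX).
- apply: (history_measurable_fun samples_iid t.+1).
  apply: measurable_funM; first by apply: sample_ind_measurable; rewrite leqnn.
  by apply: measurableT_comp => //; apply: rw_measurable; rewrite leqnn.
- by move=> w; rewrite mulr_ge0 ?sample_ind_ge0.
move=> A0 B mA mB.
set E := X @^-1` A0.
have mE : measurable (E : set (history t)) by rewrite -[X in measurable X]setTI; exact: mX.
have mE' : measurable (E : set Omega) by exact: (history_measurable samples_iid t _ mE).
have mpB C : measurable C -> measurable (psi @^-1` C).
  by move=> mC; rewrite -[X in measurable X]setTI; exact: mpsi.
have ev C w : (s t.+1 w = a /\ s' t.+1 w = b) -> 
   event t.+1 a b (psi @^-1` C) w = C (sample_ind t.+1 a b w * psi (rw t.+1 w)).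
  move=> [wa wb]; rewrite /sample_event /sample_ind /= wa wb !eqxx mul1r.
  by apply/propext; split => [[_ []]|].
have nev C w : ~ (s t.+1 w = a /\ s' t.+1 w = b) ->
   sample_ind t.+1 a b w * psi (rw t.+1 w) = 0 /\ ~ event t.+1 a b C w.
  move=> h; split; last by move=> [? [? _]]; exact: h.
  rewrite /sample_ind; case: eqP => /= [wa|]; last by rewrite mul0r.
  by case: eqP => [wb|]; rewrite ?mul0r//; exfalso; apply: h.
(* Off the chosen pair of states the product is 0. Hence the preimage of [B] is a sample event when
   0 is outside [B], and the complement of one otherwise. *)
have [B0|B0] := pselect (B 0).
  have -> : (fun w => sample_ind t.+1 a b w * psi (rw t.+1 w)) @^-1` B =
      ~` event t.+1 a b (psi @^-1` (~` B)).
    apply/seteqP; split => w /=.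
      have [h|h] := pselect (s t.+1 w = a /\ s' t.+1 w = b); first by rewrite ev// => Bw nB; exact: (nB Bw).
      by move=> _; exact: (nev _ _ h).2.
    have [h|h] := pselect (s t.+1 w = a /\ s' t.+1 w = b).
      by rewrite ev// => /contrapT.
    by rewrite (nev setT _ h).1.
  set V := event _ _ _ _.
  have mV : measurable V.
    by apply: (measurable_sample_event samples_iid); apply: mpB; exact: measurableC.
  rewrite -setDE measureD ?ltey_eq ?fin_num_measure// probability_setC//.
  have mCB : measurable (psi @^-1` (~` B)) by apply: mpB; exact: measurableC.
  have [x xE] : exists x, P E = x%:E by exists (fine (P E)); rewrite fineK ?fin_num_measure.
  have [y yE] : exists x, P V = x%:E.
    by exists (fine (P V)); rewrite fineK ?fin_num_measure.
  have VE : (P (E `&` V) = y%:E * x%:E)%E.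
    by rewrite -xE -yE setIC; exact: (history_indep samples_iid).
  rewrite [X in (X - _)%E](_ : _ = x%:E)// [X in (_ - X)%E](_ : _ = y%:E * x%:E)%E//.
  by rewrite xE yE -EFinM -!EFinB -EFinM; congr EFin; ring.
have -> : (fun w => sample_ind t.+1 a b w * psi (rw t.+1 w)) @^-1` B =
    event t.+1 a b (psi @^-1` B).
  apply/seteqP; split => w /=.
    have [h|h] := pselect (s t.+1 w = a /\ s' t.+1 w = b); first by rewrite -(ev B).
    by rewrite (nev setT _ h).1.
  have [h|h] := pselect (s t.+1 w = a /\ s' t.+1 w = b); first by rewrite -(ev B).
  by move=> /(nev _ _ h).2.
by rewrite setIC [RHS]muleC; exact: (history_indep samples_iid t a b _ E (mpB B mB) mE).
Qed.

End history_step.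

(** * Integrating out one sample given the past *)

Section td_process.
Context {R : realType} {dO : measure_display} {Omega : measurableType dO}.
Context {P : probability Omega R} {S : finType} {d : nat} {gamma : R}.
Context {s s' : nat -> Omega -> S} {rw : nat -> Omega -> R}.
Context {Pk : S -> S -> R} {mu r : S -> R} {phi : S -> 'cV[R]_d} {lambda0 : R}.
Context {eta : nat -> R}.
Hypothesis gamma01 : 0 <= gamma < 1.
Hypothesis kernelP : is_kernel Pk.
Hypothesis muP : is_stationary Pk mu.
Hypothesis phi1 : forall a, norm2 (phi a) <= 1.
Hypothesis lambda0P : is_lambda_min (TD_Sigma mu phi) lambda0.
Hypothesis lambda0_gt0 : 0 < lambda0.
Hypothesis samples_iid : iid_samples P s s' rw.
Hypothesis samples_law : sample_law P s s' rw Pk mu r.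
Hypothesis eta_ge0 : forall t, 0 <= eta t.

Local Notation history t := (@history R dO Omega S s s' rw t).
Local Notation sample_ind := (@sample_ind R dO Omega S s s').

Let rw01 t w : 0 <= rw t.+1 w <= 1.
Proof. by have [_ [_ [+ _]]] := samples_law; exact. Qed.

Let rw0 t w : 0 <= rw t.+1 w. Proof. by case/andP: (rw01 t w). Qed.
Let rw1 t w : 0 <= 1 - rw t.+1 w. Proof. by rewrite subr_ge0; case/andP: (rw01 t w). Qed.

Lemma measurable_rw t : measurable_fun setT (rw t).
Proof. by have [_ [_ [+ _]]] := samples_iid; exact. Qed.

Lemma measurable_sample_ind t a b : measurable_fun setT (sample_ind t.+1 a b).
Proof.
apply: (history_measurable_fun samples_iid t.+1).
by apply: sample_ind_measurable; rewrite leqnn.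
Qed.

Lemma integral_sample_ind t a b :
  (\int[P]_w (sample_ind t.+1 a b w)%:E)%E = (mu a * Pk a b)%:E.
Proof.
have [ms [ms' _]] := samples_iid.
have mE : measurable [set w | s t.+1 w = a /\ s' t.+1 w = b].
  by apply: measurableI; [exact: ms|exact: ms'].
have [_ [pE _]] := samples_law.
rewrite -(pE t.+1 a b)// /prob fineK ?fin_num_measure// -[in RHS](setIT [set w | _]) -integral_indic//.
apply: eq_integral => w _; rewrite indicE /sample_ind; congr ((nat_of_bool _)%:R%:E).
apply/idP/idP => [/andP[/eqP wa /eqP wb]|]; first by rewrite inE.
by rewrite inE => -[-> ->]; rewrite !eqxx.
Qed.

(** Mean of the reward on the event that the pair of states is [(a, b)]; [integral_reward_mass]
    shows that [fine] discards nothing. *)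
Definition reward_mass t a b : R :=
  fine (\int[P]_w (sample_ind t.+1 a b w * rw t.+1 w)%:E)%E.

(** Both integrals are nonnegative and add up to the finite probability of the pair, so each is
    finite and the second is the difference. *)
Lemma integral_reward_mass t a b :
  (\int[P]_w (sample_ind t.+1 a b w * rw t.+1 w)%:E = (reward_mass t a b)%:E /\
  \int[P]_w (sample_ind t.+1 a b w * (1 - rw t.+1 w))%:E
    = (mu a * Pk a b - reward_mass t a b)%:E)%E.
Proof.
have mr := measurable_rw t.+1; have mi := measurable_sample_ind t a b.
have i0 := sample_ind_ge0 t.+1 a b.
pose I1 := (\int[P]_w (sample_ind t.+1 a b w * rw t.+1 w)%:E)%E.
pose I0 := (\int[P]_w (sample_ind t.+1 a b w * (1 - rw t.+1 w))%:E)%E.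
have I1_ge0 : (0 <= I1)%E by apply: integral_ge0 => w _; rewrite lee_fin mulr_ge0.
have I0_ge0 : (0 <= I0)%E by apply: integral_ge0 => w _; rewrite lee_fin mulr_ge0.
have I01 : (I1 + I0 = (mu a * Pk a b)%:E)%E.
  rewrite -(integral_sample_ind t) -ge0_integralD//.
  - by apply: eq_integral => w _; rewrite -EFinD; congr EFin; ring.
  - by move=> w _; rewrite lee_fin mulr_ge0.
  - by apply/measurable_EFinP; exact: measurable_funM.
  - by move=> w _; rewrite lee_fin mulr_ge0.
  - by apply/measurable_EFinP; apply: measurable_funM => //; exact: measurable_funB.
move: I01; rewrite /reward_mass -/I1 -/I0.
case: I1 I1_ge0 => [x| |] //; case: I0 I0_ge0 => [y| |] // _ _ /=.
by move=> [<-]; split => //; congr EFin; ring.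
Qed.

Lemma sum_reward_mass t a : \sum_b reward_mass t a b = mu a * r a.
Proof.
have [_ [_ [_ rlaw]]] := samples_law.
have := rlaw t.+1 a isT; rewrite mulrC => h.
apply: EFin_inj; rewrite -h -sumEFin.
under eq_bigr do rewrite -(integral_reward_mass _ _ _).1.
rewrite -ge0_integral_sum//.
- apply: eq_integral => w _; rewrite sumEFin; congr EFin.
  rewrite (bigD1 (s' t.+1 w))//= big1 ?addr0 /sample_ind ?eqxx ?andbT 1?mulrC//.
  by move=> b bw; rewrite (eq_sym _ b) (negPf bw) andbF mul0r.
- move=> b; apply/measurable_EFinP; apply: measurable_funM; last exact: measurable_rw.
  exact: measurable_sample_ind.
- by move=> b w _; rewrite lee_fin mulr_ge0// sample_ind_ge0.
Qed.

Lemma integral_EFinZ (f : Omega -> R) (c : R) :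
  measurable_fun setT f -> (forall w, 0 <= f w) -> 0 <= c ->
  (\int[P]_w (f w)%:E * c%:E = \int[P]_w (c * f w)%:E)%E.
Proof.
move=> mf f0 c0; under [RHS]eq_integral do rewrite EFinM.
by rewrite muleC ge0_integralZl_EFin//; [move=> w _; rewrite lee_fin | exact/measurable_EFinP].
Qed.

(** This takes the place of a conditional expectation given the first [t] samples. The integrand is
    split by the pair of states, each term factors by independence, and the terms are reassembled;
    [k0] and [k1] are the values at rewards 0 and 1. *)
Lemma integral_history_step t (k0 k1 : S -> S -> Omega -> R) :
  (forall a b, measurable_fun setT (k0 a b : history t -> R)) ->
  (forall a b, measurable_fun setT (k1 a b : history t -> R)) ->
  (forall a b w, 0 <= k0 a b w) -> (forall a b w, 0 <= k1 a b w) ->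
  (\int[P]_w ((1 - rw t.+1 w) * k0 (s t.+1 w) (s' t.+1 w) w
             + rw t.+1 w * k1 (s t.+1 w) (s' t.+1 w) w)%:E =
  \int[P]_w (\sum_a \sum_b ((mu a * Pk a b - reward_mass t a b) * k0 a b w
                            + reward_mass t a b * k1 a b w))%:E)%E.
Proof.
move=> mk0 mk1 k0_ge0 k1_ge0.
have mr := measurable_rw t.+1.
have mk0' a b : measurable_fun setT (k0 a b) by exact: (history_measurable_fun samples_iid t _ (mk0 a b)).
have mk1' a b : measurable_fun setT (k1 a b) by exact: (history_measurable_fun samples_iid t _ (mk1 a b)).
pose L a b w := k0 a b w * (sample_ind t.+1 a b w * (1 - rw t.+1 w)).
pose L' a b w := k1 a b w * (sample_ind t.+1 a b w * rw t.+1 w).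
have L0 a b w : 0 <= L a b w by rewrite !mulr_ge0// sample_ind_ge0.
have L'0 a b w : 0 <= L' a b w by rewrite !mulr_ge0// sample_ind_ge0.
have mL a b : measurable_fun setT (L a b).
  apply: measurable_funM => //; apply: measurable_funM; first exact: measurable_sample_ind.
  exact: measurable_funB.
have mL' a b : measurable_fun setT (L' a b).
  by apply: measurable_funM => //; apply: measurable_funM => //; exact: measurable_sample_ind.
have q0 a b : 0 <= mu a * Pk a b - reward_mass t a b.
  rewrite -lee_fin -(integral_reward_mass _ _ _).2 integral_ge0// => w _.
  by rewrite lee_fin mulr_ge0// sample_ind_ge0.
have q1 a b : 0 <= reward_mass t a b.
  rewrite -lee_fin -(integral_reward_mass _ _ _).1 integral_ge0// => w _.
  by rewrite lee_fin mulr_ge0// sample_ind_ge0.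
transitivity (\int[P]_w (\sum_(x : S * S) (L x.1 x.2 w + L' x.1 x.2 w)%:E))%E.
  apply: eq_integral => w _; rewrite sumEFin; congr EFin.
  rewrite -(pair_bigA _ (fun a b => L a b w + L' a b w))/=.
  rewrite (sample_indE t.+1 (fun a b => k0 a b w)) (sample_indE t.+1 (fun a b => k1 a b w)).
  rewrite !mulr_sumr -big_split; apply: eq_bigr => a _.
  rewrite !mulr_sumr -big_split; apply: eq_bigr => b _.
  by rewrite /L /L' /=; ring.
transitivity (\int[P]_w (\sum_(x : S * S)
   ((mu x.1 * Pk x.1 x.2 - reward_mass t x.1 x.2) * k0 x.1 x.2 w
    + reward_mass t x.1 x.2 * k1 x.1 x.2 w)%:E))%E; last first.
  by apply: eq_integral => w _; rewrite sumEFin pair_bigA.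
rewrite !ge0_integral_sum//.
- apply: eq_bigr => -[a b] _ /=.
  under eq_integral do rewrite EFinD.
  under [RHS]eq_integral do rewrite EFinD.
  rewrite !ge0_integralD//.
  + congr (_ + _)%E; rewrite /L /L'.
      transitivity (\int[P]_w (k0 a b w)%:E * (mu a * Pk a b - reward_mass t a b)%:E)%E.
        rewrite -(integral_reward_mass _ _ _).2.
        apply: (ge0_integral_history samples_iid t (k0 a b) (fun y => 1 - y)) => //.
        exact: measurable_funB.
      exact: integral_EFinZ.
    transitivity (\int[P]_w (k1 a b w)%:E * (reward_mass t a b)%:E)%E.
      rewrite -(integral_reward_mass _ _ _).1.
      exact: (ge0_integral_history samples_iid t (k1 a b) (fun y => y)).
    exact: integral_EFinZ.
  + by move=> w _; rewrite lee_fin mulr_ge0.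
  + by apply/measurable_EFinP; exact: measurable_funM.
  + by move=> w _; rewrite lee_fin mulr_ge0.
  + by apply/measurable_EFinP; exact: measurable_funM.
  + by move=> w _; rewrite lee_fin.
  + exact/measurable_EFinP.
  + by move=> w _; rewrite lee_fin.
  + exact/measurable_EFinP.
- move=> x; apply/measurable_EFinP; apply: measurable_funD; exact: measurable_funM.
- by move=> x w _; rewrite lee_fin addr_ge0// mulr_ge0.
- by move=> x; apply/measurable_EFinP; exact: measurable_funD.
- by move=> x w _; rewrite lee_fin addr_ge0.
Qed.

End td_process.

(** * Coordinatewise measurability of random vectors *)

Section measurable_vectors.
Context {R : realType} {dT : measure_display} {T : measurableType dT} {d : nat}.

Definition vec_measurable (U : T -> 'cV[R]_d) :=
  forall i, measurable_fun setT (fun w => U w i 0).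

Lemma vec_measurable_cst v : vec_measurable (fun=> v).
Proof. by move=> i; exact: measurable_cst. Qed.

Lemma vec_measurableB (U V : T -> 'cV[R]_d) :
  vec_measurable U -> vec_measurable V -> vec_measurable (fun w => U w - V w).
Proof.
move=> mU mV i; rewrite (_ : (fun w => _) = fun w => U w i 0 - V w i 0).
  exact: measurable_funB.
by apply/funext => w; rewrite !mxE.
Qed.

Lemma vec_measurableZ (f : T -> R) (U : T -> 'cV[R]_d) :
  measurable_fun setT f -> vec_measurable U -> vec_measurable (fun w => f w *: U w).
Proof.
move=> mf mU i; rewrite (_ : (fun w => _) = fun w => f w * U w i 0).
  exact: measurable_funM.
by apply/funext => w; rewrite !mxE.
Qed.

Lemma vec_measurable_mul (M : 'M[R]_d) (U : T -> 'cV[R]_d) :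
  vec_measurable U -> vec_measurable (fun w => M *m U w).
Proof.
move=> mU i; rewrite (_ : (fun w => _) = fun w => \sum_j M i j * U w j 0).
  by apply: measurable_sum => j; apply: measurable_funM => //; exact: measurable_cst.
by apply/funext => w; rewrite !mxE.
Qed.

Lemma measurable_dot (U V : T -> 'cV[R]_d) : vec_measurable U -> vec_measurable V ->
  measurable_fun setT (fun w => dot (U w) (V w)).
Proof.
move=> mU mV; rewrite (_ : (fun w => _) = fun w => \sum_i U w i 0 * V w i 0).
  by apply: measurable_sum => i; apply: measurable_funM.
by apply/funext => w; rewrite dotE.
Qed.

End measurable_vectors.

(** * The exponential inequality for one step of the TD process *)

Section td_step_inequality.
Context {R : realType} {dO : measure_display} {Omega : measurableType dO}.
Context {P : probability Omega R} {S : finType} {d : nat} {gamma : R}.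
Context {s s' : nat -> Omega -> S} {rw : nat -> Omega -> R}.
Context {Pk : S -> S -> R} {mu r : S -> R} {phi : S -> 'cV[R]_d} {lambda0 : R}.
Context {eta : nat -> R}.
Hypothesis gamma01 : 0 <= gamma < 1.
Hypothesis kernelP : is_kernel Pk.
Hypothesis muP : is_stationary Pk mu.
Hypothesis phi1 : forall a, norm2 (phi a) <= 1.
Hypothesis lambda0P : is_lambda_min (TD_Sigma mu phi) lambda0.
Hypothesis lambda0_gt0 : 0 < lambda0.
Hypothesis samples_iid : iid_samples P s s' rw.
Hypothesis samples_law : sample_law P s s' rw Pk mu r.
Hypothesis eta_ge0 : forall t, 0 <= eta t.

Local Notation history t := (@history R dO Omega S s s' rw t).
Local Notation thstar := (theta_star gamma Pk mu r phi).
Local Notation M := (2 * norm2 thstar + 1).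
Local Notation sqerr := (@sqerr R S d gamma Pk mu r phi).
Local Notation td_kernel := (@td_kernel R S d gamma Pk mu r phi).
Local Notation td_drift := (@td_drift R S d gamma Pk mu r phi).
Local Notation td_vproxy := (@td_vproxy R S d gamma Pk mu r phi).
Local Notation td_step := (@td_step R S d gamma phi).
Local Notation td_error := (@td_error R S d gamma phi).

Definition td_path t (w : Omega) : 'cV[R]_d :=
  TD_iter gamma phi eta (fun k => s k w) (fun k => s' k w) (fun k => rw k w) t.

Definition td_sqerr t w : R := sqerr (td_path t w).

Lemma td_path_measurable t : vec_measurable (td_path t : history t -> _).
Proof.
elim: t => [|t IH] i; first exact: measurable_cst.
(* The new states are frozen at [a] and [b]; [sample_fun_measurable] puts the random ones back. *)
pose f a b w := td_step (eta t.+1) (td_path t w) a b (rw t.+1 w) i 0.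
apply: (sample_fun_measurable t.+1 t.+1 f); first by rewrite leqnn.
move=> a b.
have IH' : vec_measurable (td_path t : history t.+1 -> _).
  by move=> j; apply: (history_measurable_funS t _ (IH j)).
apply: (@vec_measurableB _ _ (history t.+1) d (td_path t)
  (fun w => eta t.+1 *: (phi a *m (phi a - gamma *: phi b)^T *m td_path t w
     - rw t.+1 w *: phi a))) => //.
apply: vec_measurableZ; first exact: measurable_cst.
apply: vec_measurableB; first exact: vec_measurable_mul.
apply: vec_measurableZ; last exact: vec_measurable_cst.
by apply: rw_measurable; rewrite leqnn.
Qed.

Let td_err_measurable t : vec_measurable ((fun w => td_path t w - thstar) : history t -> _).
Proof. exact: (vec_measurableB _ _ (td_path_measurable t) (vec_measurable_cst _)). Qed.

Lemma td_sqerr_measurable t : measurable_fun setT (td_sqerr t : history t -> R).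
Proof. by apply: measurable_dot. Qed.

Lemma td_sqerr_measurableS t : measurable_fun setT (td_sqerr t : history t.+1 -> R).
Proof. exact: (history_measurable_funS t _ (td_sqerr_measurable t)). Qed.

Lemma td_drift_measurable t (c : Omega -> R) e :
  measurable_fun setT (c : history t -> R) ->
  measurable_fun setT ((fun w => td_drift (c w) e (td_path t w)) : history t -> R).
Proof.
move=> mc; apply: measurable_funM.
  apply: measurable_funM; last exact: measurable_cst.
  by apply: measurable_funM => //; exact: measurable_cst.
by apply: measurable_dot => //; exact: vec_measurable_mul.
Qed.

Let mM2 t : measurable_fun setT ((fun w => td_sqerr t w + M ^+ 2) : history t -> R).
Proof. by apply: measurable_funD; [exact: td_sqerr_measurable|exact: measurable_cst]. Qed.

Lemma td_vproxy_measurable t (c : Omega -> R) e :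
  measurable_fun setT (c : history t -> R) ->
  measurable_fun setT ((fun w => td_vproxy (c w) e (td_path t w)) : history t -> R).
Proof.
move=> mc; apply: measurable_funM; first exact: measurable_cst.
apply: measurable_funM; last by apply: measurable_funM => //; exact: td_sqerr_measurable.
apply: measurable_funM; last exact: measurable_cst.
exact: measurable_funX.
Qed.

Lemma td_kernel_measurable t (c : Omega -> R) e a b y :
  measurable_fun setT (c : history t -> R) ->
  measurable_fun setT ((fun w => td_kernel (c w) e (td_path t w) a b y) : history t -> R).
Proof.
move=> mc; apply: measurable_funD; last first.
  by apply: measurableT_comp => //; exact: td_vproxy_measurable.
apply: measurable_funB; last exact: td_drift_measurable.
apply: measurable_funM.
  apply: measurable_funM; last exact: measurable_cst.
  by apply: measurable_funM => //; exact: measurable_cst.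
apply: measurable_funM.
  by apply: measurable_dot => //; exact: vec_measurable_cst.
apply: measurable_funB; last exact: measurable_cst.
by apply: measurable_dot; [exact: vec_measurable_cst|exact: td_path_measurable].
Qed.

(** The supermartingale-type inequality behind both stages, tested against a nonnegative weight [h]
    known at time [t]. The multiplier [c] may depend on the past: stage 1 takes [p / energy t w],
    stage 2 the constant [rate t.+1]. *)
Lemma integral_td_step t (h c : Omega -> R) :
  measurable_fun setT (h : history t -> R) -> measurable_fun setT (c : history t -> R) ->
  (forall w, 0 <= h w) -> (forall w, 0 <= c w) ->
  (\int[P]_w (h w * expR (c w * (td_sqerr t.+1 w - td_sqerr t w)))%:E <=
   \int[P]_w (h w * expR (8 * (c w * eta t.+1 ^+ 2 * (td_sqerr t w + M ^+ 2))
     - 2 * c w * eta t.+1 * ((1 - gamma) * lambda0 * td_sqerr t w)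
     + 256 * (c w ^+ 2 * eta t.+1 ^+ 2 * (td_sqerr t w * (td_sqerr t w + M ^+ 2)))))%:E)%E.
Proof.
move=> mh mc h0 c0; set e := eta t.+1; have e0 : 0 <= e by exact: eta_ge0.
pose th := td_path t.
(* [g] gathers every factor already determined by the first [t] samples. *)
pose g w := h w * expR (8 * (c w * e ^+ 2 * (td_sqerr t w + M ^+ 2)) + td_drift (c w) e (th w)).
have g0 w : 0 <= g w by rewrite mulr_ge0 ?expR_ge0.
have mg : measurable_fun setT (g : history t -> R).
  apply: measurable_funM => //; apply: measurableT_comp => //.
  apply: measurable_funD; last exact: td_drift_measurable.
  apply: measurable_funM; first exact: measurable_cst.
  by apply: measurable_funM => //; apply: measurable_funM => //; exact: measurable_cst.
pose k (y : R) a b w := g w * td_kernel (c w) e (th w) a b y.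
have rw01 w : 0 <= rw t.+1 w <= 1 by have [_ [_ [+ _]]] := samples_law; exact.
have k_ge0 y a b w : 0 <= y <= 1 -> 0 <= k y a b w.
  by move=> y01; rewrite mulr_ge0// (td_kernel_ge0 gamma01 kernelP muP).
have mk y a b : measurable_fun setT (k y a b : history t -> R).
  by apply: measurable_funM => //; exact: td_kernel_measurable.
have i0 : 0 <= (0 : R) <= 1 by rewrite lexx ler01.
have i1 : 0 <= (1 : R) <= 1 by rewrite lexx ler01.
apply: (@le_trans _ _ (\int[P]_w ((1 - rw t.+1 w) * k 0 (s t.+1 w) (s' t.+1 w) w
   + rw t.+1 w * k 1 (s t.+1 w) (s' t.+1 w) w)%:E)%E).
  apply: ge0_le_integral => //.
  - by move=> w _; rewrite lee_fin mulr_ge0 ?expR_ge0.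
  - apply/measurable_EFinP; apply: (history_measurable_fun samples_iid t.+1).
    apply: measurable_funM; first exact: (history_measurable_funS t h mh).
    apply: measurableT_comp => //; apply: measurable_funM.
      exact: (history_measurable_funS t c mc).
    by apply: measurable_funB; [exact: td_sqerr_measurable|exact: td_sqerr_measurableS].
  - apply/measurable_EFinP; apply: (history_measurable_fun samples_iid t.+1).
    have mr : measurable_fun setT (rw t.+1 : history t.+1 -> R).
      by apply: rw_measurable; rewrite leqnn.
    have mks y : measurable_fun setT
       ((fun w => k y (s t.+1 w) (s' t.+1 w) w) : history t.+1 -> R).
      apply: (sample_fun_measurable t.+1 t.+1 (k y)); first by rewrite leqnn.
      by move=> a b; exact: (history_measurable_funS t _ (mk y a b)).
    apply: measurable_funD; apply: measurable_funM => //.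
    exact: measurable_funB.
  - move=> w _; rewrite lee_fin.
    have step := expR_sqerr_td_step gamma01 kernelP muP phi1 (r := r) (c w) e (th w)
      (s t.+1 w) (s' t.+1 w) (rw t.+1 w) (c0 w) e0 (rw01 w).
    apply: (le_trans (ler_wpM2l (h0 w) step)).
    by rewrite le_eqVlt; apply/orP; left; apply/eqP; rewrite /k /g; ring.
rewrite (integral_history_step samples_iid samples_law)//; last 2 first.
- by move=> a b w; exact: k_ge0.
- by move=> a b w; exact: k_ge0.
have mgB : measurable_fun setT g by exact: (history_measurable_fun samples_iid t g mg).
apply: ge0_le_integral => //.
- move=> w _; rewrite lee_fin.
  under eq_bigr => a _ do under eq_bigr => b _ do
    rewrite /k !(mulrCA _ (g w)) -mulrDr.
  under eq_bigr => a _ do rewrite -mulr_sumr.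
  rewrite -mulr_sumr (mean_td_kernel gamma01 kernelP muP lambda0P lambda0_gt0).
    by rewrite mulr_ge0 ?expR_ge0.
  by move=> a; exact: (sum_reward_mass samples_iid samples_law).
- apply/measurable_EFinP; apply: (history_measurable_fun samples_iid t).
  apply: measurable_sum => a; apply: measurable_sum => b.
  by apply: measurable_funD; apply: measurable_funM => //; exact: measurable_cst.
- apply/measurable_EFinP; apply: (history_measurable_fun samples_iid t).
  have mY := td_sqerr_measurable t; have mW := mM2 t.
  apply: measurable_funM => //; apply: measurableT_comp => //.
  apply: measurable_funD; last first.
    apply: measurable_funM; first exact: measurable_cst.
    apply: measurable_funM; last exact: measurable_funM.
    by apply: measurable_funM; [exact: measurable_funX|exact: measurable_cst].
  apply: measurable_funB.
    apply: measurable_funM; first exact: measurable_cst.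
    by apply: measurable_funM => //; apply: measurable_funM => //; exact: measurable_cst.
  apply: measurable_funM.
    apply: measurable_funM; last exact: measurable_cst.
    by apply: measurable_funM => //; exact: measurable_cst.
  by apply: measurable_funM => //; exact: measurable_cst.
- move=> w _; rewrite lee_fin.
  under eq_bigr => a _ do under eq_bigr => b _ do
    rewrite /k !(mulrCA _ (g w)) -mulrDr.
  under eq_bigr => a _ do rewrite -mulr_sumr.
  rewrite -mulr_sumr (mean_td_kernel gamma01 kernelP muP lambda0P lambda0_gt0); last first.
    by move=> a; exact: (sum_reward_mass samples_iid samples_law).
  rewrite /g -mulrA ler_wpM2l// -expRD ler_expR.
  have drift : td_drift (c w) e (th w)
      <= - 2 * c w * e * ((1 - gamma) * lambda0 * td_sqerr t w).
    exact: (td_drift_le gamma01 kernelP muP lambda0P).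
  rewrite [td_vproxy _ _ _](_ : _ =
    256 * (c w ^+ 2 * e ^+ 2 * (td_sqerr t w * (td_sqerr t w + M ^+ 2))))//.
  by rewrite lerD2r lerD2l (le_trans drift)// !mulNr.
Qed.

End td_step_inequality.

(** * Markov's inequality and integrals of nonnegative functions *)

Section chernoff.
Context {R : realType} {dO : measure_display} {Omega : measurableType dO}.
Variable P : probability Omega R.

Lemma markov_indic (E : set Omega) (f : Omega -> R) (a : R) : measurable E ->
  measurable_fun setT f -> 0 <= a -> (forall w, a * \1_E w <= f w) ->
  (a%:E * P E <= \int[P]_w (f w)%:E)%E.
Proof.
move=> mE mf a0 af.
rewrite -[E in leLHS]setIT -integral_indic// -ge0_integralZl_EFin//.
- apply: ge0_le_integral => //.
  + by move=> w _; rewrite -EFinM lee_fin mulr_ge0.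
  + by apply/measurable_EFinP; apply: measurable_funM => //; exact: measurable_indic.
  + exact/measurable_EFinP.
  + by move=> w _; rewrite -EFinM lee_fin.
- by apply: measurableT_comp; [exact: EFin_measurable|exact: measurable_indic].
Qed.

Lemma ge0_integral_EFinD (f g : Omega -> R) :
  measurable_fun setT f -> measurable_fun setT g ->
  (forall w, 0 <= f w) -> (forall w, 0 <= g w) ->
  (\int[P]_w (f w + g w)%:E = \int[P]_w (f w)%:E + \int[P]_w (g w)%:E)%E.
Proof.
move=> mf mg f0 g0; under eq_integral do rewrite EFinD.
apply: ge0_integralD => //; do ?[by move=> w _; rewrite lee_fin].
- exact/measurable_EFinP.
- exact/measurable_EFinP.
Qed.

Lemma ge0_le_integral_EFin (f g : Omega -> R) :
  measurable_fun setT f -> measurable_fun setT g ->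
  (forall w, 0 <= f w) -> (forall w, f w <= g w) ->
  (\int[P]_w (f w)%:E <= \int[P]_w (g w)%:E)%E.
Proof.
move=> mf mg f0 fg; apply: ge0_le_integral; first exact: measurableT.
- by move=> w _; rewrite lee_fin.
- exact/measurable_EFinP.
- exact/measurable_EFinP.
- by move=> w _; rewrite lee_fin.
Qed.

Lemma indic_ge0 (E : set Omega) w : 0 <= \1_E w :> R.
Proof. by rewrite indicE. Qed.

Lemma indic_le (E1 E2 : set Omega) w : E1 `<=` E2 -> \1_E1 w <= \1_E2 w :> R.
Proof.
move=> E12; rewrite !indicE ler_nat.
have [/set_mem/E12/mem_set ->|//] := boolP (w \in E1); exact: leq_b1.
Qed.

End chernoff.

(** * The energy process and the event that it stays bounded *)

Section two_stage.
Context {R : realType} {dO : measure_display} {Omega : measurableType dO}.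
Context {P : probability Omega R} {S : finType} {d : nat} {gamma : R}.
Context {s s' : nat -> Omega -> S} {rw : nat -> Omega -> R}.
Context {Pk : S -> S -> R} {mu r : S -> R} {phi : S -> 'cV[R]_d} {lambda0 : R}.
Context {eta : nat -> R}.
Hypothesis gamma01 : 0 <= gamma < 1.
Hypothesis kernelP : is_kernel Pk.
Hypothesis muP : is_stationary Pk mu.
Hypothesis phi1 : forall a, norm2 (phi a) <= 1.
Hypothesis lambda0P : is_lambda_min (TD_Sigma mu phi) lambda0.
Hypothesis lambda0_gt0 : 0 < lambda0.
Hypothesis samples_iid : iid_samples P s s' rw.
Hypothesis samples_law : sample_law P s s' rw Pk mu r.
Hypothesis eta_ge0 : forall t, 0 <= eta t.

Local Notation history t := (@history R dO Omega S s s' rw t).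
Local Notation thstar := (theta_star gamma Pk mu r phi).
Local Notation M := (2 * norm2 thstar + 1).
Local Notation kappa := ((1 - gamma) * lambda0).
Local Notation Y := (@td_sqerr R dO Omega S d gamma s s' rw Pk mu r phi eta).
Local Notation mY := (@td_sqerr_measurable R dO Omega S d gamma s s' rw Pk mu r phi eta).

(** Adding [M ^+ 2] keeps the logarithm nonnegative and makes the squared noise of a step at most 8
    times the energy. *)
Definition energy t w : R := Y t w + M ^+ 2.

Let kappa_gt0 : 0 < kappa.
Proof. by case/andP: gamma01 => _ g1; rewrite mulr_gt0// subr_gt0. Qed.

Lemma td_sqerr_ge0 t w : 0 <= Y t w. Proof. exact: sqerr_ge0. Qed.

Lemma td_bias_ge1 : 1 <= M.
Proof. by have := norm2_ge0 thstar; lra. Qed.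

Lemma energy_ge1 t w : 1 <= energy t w.
Proof.
rewrite /energy; have := td_sqerr_ge0 t w; have := td_bias_ge1 => M1 Y0.
have : 1 <= M ^+ 2 by rewrite expr_ge1// (le_trans ler01).
by lra.
Qed.

Lemma energy_gt0 t w : 0 < energy t w.
Proof. exact: lt_le_trans ltr01 (energy_ge1 t w). Qed.

Lemma energy_measurable t : measurable_fun setT (energy t : history t -> R).
Proof. by apply: measurable_funD; [exact: mY|exact: measurable_cst]. Qed.

(** These events decrease in [t] and belong to [history t]; their indicators do the work of a
    stopping time. *)
Definition confined (K : R) t : set Omega := [set w | forall k, (k <= t)%N -> energy k w <= K].

Lemma confinedS K t : confined K t.+1 = confined K t `&` [set w | energy t.+1 w <= K].
Proof.
apply/seteqP; split => w /=.
  by move=> h; split; [move=> k kt; apply: h; exact: leqW|exact: h].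
by move=> [h hS] k; rewrite leq_eqVlt => /predU1P[->//|]; exact: h.
Qed.

Lemma confined_le K t t' : (t <= t')%N -> confined K t' `<=` confined K t.
Proof. by move=> tt' w h k kt; apply: h; exact: leq_trans tt'. Qed.

Lemma confined_energy K t w : confined K t w -> energy t w <= K.
Proof. exact. Qed.

Let measurable_sublevel t K : measurable ([set w | energy t w <= K] : set (history t)).
Proof.
rewrite (_ : [set w | _] = setT `&` energy t @^-1` `]-oo, K]).
  by apply: energy_measurable => //; exact: measurable_itv.
by apply/seteqP; split => w /=; rewrite in_itv //= => -[].
Qed.

Lemma confined_measurable K t : measurable (confined K t : set (history t)).
Proof.
elim: t => [|t IH].
  rewrite (_ : confined K 0 = [set w | energy 0 w <= K]); first exact: measurable_sublevel.
  apply/seteqP; split => w /=; first by move/(_ 0%N isT).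
  by move=> h k; rewrite leqn0 => /eqP ->.
rewrite confinedS; apply: (@measurableI _ (history t.+1)); last exact: measurable_sublevel.
exact: (history_measurableS t _ IH).
Qed.

Lemma confined_measurable' K t : measurable (confined K t).
Proof. exact: (history_measurable samples_iid t _ (confined_measurable K t)). Qed.

(** * Stage 1: a maximal inequality for the energy *)

Section confinement.
Variables (p : R).
Hypothesis p1 : 1 <= p.

Definition potential t w : R := expR (p * ln (energy t w)).

Lemma potential_measurable t : measurable_fun setT (potential t : history t -> R).
Proof.
apply: measurableT_comp => //; apply: measurable_funM; first exact: measurable_cst.
by apply: measurableT_comp => //; exact: energy_measurable.
Qed.

Lemma potential_measurable' t : measurable_fun setT (potential t).
Proof. exact: (history_measurable_fun samples_iid t _ (potential_measurable t)). Qed.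

(** With [x] the ratio of successive energies, this is [x^p <= exp (p (x - 1))], that is,
    [ln x <= x - 1]. *)
Lemma potentialS t w : potential t.+1 w <=
  potential t w * expR (p / energy t w * (Y t.+1 w - Y t w)).
Proof.
have W0 := energy_gt0 t w; have W1 := energy_gt0 t.+1 w.
rewrite -expRD ler_expR -mulrA -mulrDr ler_wpM2l//; first exact: le_trans p1.
rewrite -lerBlDl -ln_div ?posrE//.
have -> : (energy t w)^-1 * (Y t.+1 w - Y t w) = energy t.+1 w / energy t w - 1.
  by rewrite /energy; field; rewrite -/(energy t w) gt_eqF.
have x0 : 0 < energy t.+1 w / energy t w by rewrite divr_gt0.
by rewrite lerBrDl -[leRHS]lnK ?posrE// expR_ge1Dx.
Qed.

(** With the multiplier [p / energy t w] the energy cancels: the noise contributes [8 p eta^2], the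
    variance at most [256 p^2 eta^2], and the favourable drift is dropped. Since [p >= 1] the sum is
    at most [264 p^2 eta^2]. *)
Lemma integral_potentialS K t :
  (\int[P]_w (\1_(confined K t) w * potential t.+1 w)%:E <=
   (expR (264 * p ^+ 2 * eta t.+1 ^+ 2))%:E *
     \int[P]_w (\1_(confined K t) w * potential t w)%:E)%E.
Proof.
have p0 : 0 <= p by exact: le_trans p1.
have mC : measurable_fun setT (\1_(confined K t) : history t -> R).
  by apply: measurable_indic; exact: confined_measurable.
have mh : measurable_fun setT
    ((fun w => \1_(confined K t) w * potential t w) : history t -> R).
  by apply: measurable_funM => //; exact: potential_measurable.
have h0 w : 0 <= \1_(confined K t) w * potential t w.
  by rewrite mulr_ge0 ?indic_ge0 ?expR_ge0.
have mc : measurable_fun setT ((fun w => p / energy t w) : history t -> R).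
  (* The inverse is written through [expR] and [ln] to read off its measurability. *)
  rewrite (_ : (fun w => _) = fun w => p * expR (-1 * ln (energy t w))); last first.
    by apply/funext => w; rewrite mulN1r expRN lnK// posrE energy_gt0.
  apply: measurable_funM; first exact: measurable_cst.
  apply: measurableT_comp => //; apply: measurable_funM; first exact: measurable_cst.
  by apply: measurableT_comp => //; exact: energy_measurable.
have c0 w : 0 <= p / energy t w by rewrite divr_ge0// ltW// energy_gt0.
have mhB := history_measurable_fun samples_iid t _ mh.
have mcB := history_measurable_fun samples_iid t _ mc.
have mYB k : measurable_fun setT (Y k).
  exact: (history_measurable_fun samples_iid k _ (mY k)).
apply: (@le_trans _ _ (\int[P]_w (\1_(confined K t) w * potential t w
    * expR (p / energy t w * (Y t.+1 w - Y t w)))%:E)%E).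
  apply: ge0_le_integral => //.
  - by move=> w _; rewrite lee_fin mulr_ge0 ?indic_ge0 ?expR_ge0.
  - apply/measurable_EFinP; apply: measurable_funM; last exact: potential_measurable'.
    by apply: measurable_indic; exact: confined_measurable'.
  - apply/measurable_EFinP; apply: measurable_funM => //.
    apply: measurableT_comp => //; apply: measurable_funM => //.
    exact: measurable_funB.
  - by move=> w _; rewrite lee_fin -mulrA ler_wpM2l ?indic_ge0 ?potentialS.
apply: (le_trans (integral_td_step gamma01 kernelP muP phi1 lambda0P lambda0_gt0
  samples_iid samples_law eta_ge0 t _ _ mh mc h0 c0)).
rewrite muleC (integral_EFinZ _ _ mhB h0 (expR_ge0 _)).
apply: ge0_le_integral; first exact: measurableT.
- by move=> w _; rewrite lee_fin mulr_ge0 ?expR_ge0.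
- apply/measurable_EFinP; apply: measurable_funM => //; apply: measurableT_comp => //.
  have mW : measurable_fun setT (fun w => Y t w + M ^+ 2).
    by apply: measurable_funD => //; exact: measurable_cst.
  apply: measurable_funD; last first.
    apply: measurable_funM; first exact: measurable_cst.
    apply: measurable_funM; last exact: measurable_funM.
    by apply: measurable_funM; [exact: measurable_funX|exact: measurable_cst].
  apply: measurable_funB.
    apply: measurable_funM; first exact: measurable_cst.
    by apply: measurable_funM => //; apply: measurable_funM => //; exact: measurable_cst.
  apply: measurable_funM.
    apply: measurable_funM; last exact: measurable_cst.
    by apply: measurable_funM => //; exact: measurable_cst.
  by apply: measurable_funM => //; exact: measurable_cst.
- by apply/measurable_EFinP; apply: measurable_funM => //; exact: measurable_cst.
- move=> w _; rewrite lee_fin mulrC ler_wpM2r// ler_expR -/(energy t w).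
  have W0 := energy_gt0 t w; have Y0 := td_sqerr_ge0 t w.
  set e := eta t.+1; have e0 : 0 <= e by exact: eta_ge0.
  have -> : p / energy t w * e ^+ 2 * energy t w = p * e ^+ 2.
    by field; rewrite gt_eqF.
  have -> : (p / energy t w) ^+ 2 * e ^+ 2 * (Y t w * energy t w)
      = p ^+ 2 * e ^+ 2 * (Y t w / energy t w).
    by field; rewrite gt_eqF.
  have YW : Y t w / energy t w <= 1.
    by rewrite ler_pdivrMr// mul1r /energy lerDl sqr_ge0.
  have d0 : 0 <= 2 * (p / energy t w) * e * (kappa * Y t w).
    have kY : 0 <= kappa * Y t w by rewrite mulr_ge0// ltW.
    by apply: mulr_ge0 => //; apply: mulr_ge0 => //; apply: mulr_ge0.
  have e1 : p ^+ 2 * e ^+ 2 * (Y t w / energy t w) <= p ^+ 2 * e ^+ 2.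
    by rewrite ler_piMr// mulr_ge0 ?sqr_ge0.
  have e2 : p * e ^+ 2 <= p ^+ 2 * e ^+ 2.
    by rewrite ler_wpM2r ?sqr_ge0// expr2 ler_peMl.
  lra.
Qed.

(** Ville's inequality by induction: the integrand follows the potential while the path is confined
    and is frozen at [K^p] after the exit. One step costs at most the factor of
    [integral_potentialS]. *)
Lemma confined_tail K t : 0 < K -> (forall w, energy 0 w <= K) ->
  (\int[P]_w (\1_(confined K t) w * potential t w
     + expR (p * ln K) * \1_(~` confined K t) w)%:E <=
   (expR (\sum_(1 <= k < t.+1) 264 * p ^+ 2 * eta k ^+ 2))%:E
     * \int[P]_w (potential 0 w)%:E)%E.
Proof.
move=> K0 W0K.
have mI k : measurable_fun setT (\1_(confined K k) : Omega -> R).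
  by apply: measurable_indic; exact: confined_measurable'.
have mIC k : measurable_fun setT (\1_(~` confined K k) : Omega -> R).
  by apply: measurable_indic; apply: measurableC; exact: confined_measurable'.
have mp := potential_measurable'.
have eC w k : \1_(~` confined K k) w = 1 - \1_(confined K k) w :> R.
  by rewrite !indicE in_setC; case: (_ \in _); rewrite ?subrr ?subr0.
have mA k j : measurable_fun setT (fun w => \1_(confined K k) w * potential j w).
  exact: measurable_funM.
have mB k : measurable_fun setT (fun w => expR (p * ln K) * \1_(~` confined K k) w).
  by apply: measurable_funM => //; exact: measurable_cst.
have A0 k j w : 0 <= \1_(confined K k) w * potential j w.
  by rewrite mulr_ge0 ?expR_ge0 ?indic_ge0.
have B0 k w : 0 <= expR (p * ln K) * \1_(~` confined K k) w.
  by rewrite mulr_ge0 ?expR_ge0 ?indic_ge0.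
have AB0 k j w : 0 <= \1_(confined K k) w * potential j w
    + expR (p * ln K) * \1_(~` confined K k) w by rewrite addr_ge0.
have mAB k j : measurable_fun setT (fun w => \1_(confined K k) w * potential j w
    + expR (p * ln K) * \1_(~` confined K k) w) by exact: measurable_funD.
elim: t => [|t IH].
  rewrite big_geq// expR0 mul1e; apply: ge0_le_integral_EFin => // w.
  rewrite eC indicE mem_set ?subrr ?mulr0 ?addr0 ?mul1r//.
  by move=> k; rewrite leqn0 => /eqP ->; exact: W0K.
rewrite big_nat_recr//= expRD [X in (X%:E * _)%E]mulrC EFinM -muleA.
apply: le_trans; last by apply: lee_wpmul2l IH; rewrite lee_fin expR_ge0.
rewrite (ge0_integral_EFinD P _ _ (mA t t) (mB t) (A0 t t) (B0 t)).
rewrite ge0_muleDr; last 2 first.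
- by apply: integral_ge0 => w _; rewrite lee_fin.
- by apply: integral_ge0 => w _; rewrite lee_fin.
apply: (@le_trans _ _ (\int[P]_w (\1_(confined K t) w * potential t.+1 w)%:E +
   \int[P]_w (expR (p * ln K) * \1_(~` confined K t) w)%:E)%E); last first.
  apply: leeD; first exact: integral_potentialS.
  rewrite -[leLHS]mul1e; apply: lee_wpmul2r.
    by apply: integral_ge0 => w _; rewrite lee_fin.
  rewrite lee_fin; apply: le_trans (expR_ge1Dx _); rewrite lerDl.
  exact: mulr_ge0 (mulr_ge0 (ler0n _ 264) (sqr_ge0 p)) (sqr_ge0 _).
rewrite -(ge0_integral_EFinD P _ _ (mA t t.+1) (mB t) (A0 t t.+1) (B0 t)).
apply: ge0_le_integral_EFin => //.
move=> w; rewrite !eC confinedS !indicE in_setI.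
have -> : (w \in [set w0 | energy t.+1 w0 <= K]) = (energy t.+1 w <= K).
  by apply/idP/idP; rewrite inE.
case: (w \in confined K t); case: (leP (energy t.+1 w) K) => KW /=; rewrite ?mulr1n ?mulr0n; try lra.
have : expR (p * ln K) <= potential t.+1 w.
  rewrite /potential ler_expR ler_wpM2l//; first exact: le_trans p1.
  have W1 := energy_gt0 t.+1 w.
  by rewrite ler_ln ?posrE//; exact: ltW.
lra.
Qed.

(** Markov's inequality bounds the exit probability by [e^v (W0 / K)^p], and [K = e^2 W0] turns this
    into [e^(v - 2p)]. *)
Lemma prob_not_confined W0 t v : (forall w, energy 0 w = W0) ->
  \sum_(1 <= k < t.+1) 264 * p ^+ 2 * eta k ^+ 2 <= v ->
  (P (~` confined (expR 2 * W0) t) <= (expR (v - 2 * p))%:E)%E.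
Proof.
move=> W0E vv; set K := expR 2 * W0.
have W00 : 0 < W0 by rewrite -(W0E point) energy_gt0.
have K0 : 0 < K by rewrite mulr_gt0 ?expR_gt0.
have p0 : 0 <= p by exact: le_trans p1.
have W0K w : energy 0 w <= K.
  by rewrite W0E /K ler_peMl ?(ltW W00)//; apply: le_trans (expR_ge1Dx _); lra.
have mC := confined_measurable' K t.
have mI : measurable_fun setT (\1_(confined K t) : Omega -> R) by exact: measurable_indic.
have mIC : measurable_fun setT (\1_(~` confined K t) : Omega -> R).
  by apply: measurable_indic; exact: measurableC.
have mp := potential_measurable' t.
have tail := confined_tail K t K0 W0K.
have : ((expR (p * ln K))%:E * P (~` confined K t) <=
    (expR v)%:E * (expR (p * ln W0))%:E)%E.
  apply: (le_trans (markov_indic P _ (fun w => \1_(confined K t) w * potential t w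
     + expR (p * ln K) * \1_(~` confined K t) w) _ _ _ _ _)).
  - exact: measurableC.
  - apply: measurable_funD; apply: measurable_funM => //; exact: measurable_cst.
  - exact: expR_ge0.
  - by move=> w; rewrite lerDr mulr_ge0 ?indic_ge0 ?expR_ge0.
  apply: (le_trans tail).
  under eq_integral do rewrite /potential W0E.
  rewrite integral_cst// [X in (_ * (_ * X))%E]probability_setT mule1.
  by rewrite -!EFinM lee_fin ler_wpM2r ?expR_ge0// ler_expR.
have [x xE] : exists x, P (~` confined K t) = x%:E.
  exists (fine (P (~` confined K t))); rewrite fineK// fin_num_measure//.
  exact: measurableC.
rewrite xE -!EFinM !lee_fin -expRD => h.
have : expR (p * ln K) * x <= expR (p * ln K) * expR (v - 2 * p).
  apply: (le_trans h); rewrite -expRD ler_expR /K lnM ?posrE ?expR_gt0// expRK.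
  by lra.
by rewrite ler_pM2l ?expR_gt0.
Qed.

End confinement.

(** * Stage 2: exponential moments with a growing rate *)

Section decay.
Variables (K : R) (n0 : nat).
Hypothesis K_gt0 : 0 < K.
Hypothesis n0_gt0 : (0 < n0)%N.
Hypothesis eta_gt0 : forall t, (n0 <= t)%N -> 0 < eta t.
Hypothesis eta_small : forall t, (n0 <= t)%N -> kappa * eta t <= 2.
Hypothesis eta_slow : forall t, (n0 <= t)%N ->
  eta t * (1 - kappa * eta t.+1) <= eta t.+1 * (1 - kappa * eta t.+1 / 2).

(* Chosen so that, on [confined K t], the variance proxy of one step is absorbed by half of the drift. *)
Definition rate t : R := kappa / (256 * K * eta t).

Let K256 : 0 < 256 * K. Proof. exact: mulr_gt0 (ltr0Sn _ 255) K_gt0. Qed.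

Lemma rate_gt0 t : (n0 <= t)%N -> 0 < rate t.
Proof.
move=> nt; apply: divr_gt0; first exact: kappa_gt0.
exact: mulr_gt0 K256 (eta_gt0 t nt).
Qed.

(** Since [rate t * eta t] is the constant [kappa / (256 K)], half of the drift pays for the
    variance ([h2]). The other half contracts, and [eta_slow] trades [rate t.+1] for [rate t] at the
    cost of half of that contraction ([h3]). The noise leaves [8 / 256] of [kappa * eta t.+1],
    written as [1 / 16] of the convex weight ([h1]). *)
Lemma rate_step t w : (n0 <= t)%N -> energy t w <= K ->
  rate t.+1 * Y t w + (8 * (rate t.+1 * eta t.+1 ^+ 2 * energy t w)
     - 2 * rate t.+1 * eta t.+1 * (kappa * Y t w)
     + 256 * (rate t.+1 ^+ 2 * eta t.+1 ^+ 2 * (Y t w * energy t w))) <=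
  (1 - kappa * eta t.+1 / 2) * (rate t * Y t w) + kappa * eta t.+1 / 2 * (1 / 16).
Proof.
move=> nt WK; have Y0 := td_sqerr_ge0 t w.
have e0 : 0 < eta t by exact: eta_gt0.
have e1 : 0 < eta t.+1 by apply: eta_gt0; exact: leqW.
have r1 : 0 < rate t.+1 by apply: rate_gt0; exact: leqW.
have reta : rate t.+1 * eta t.+1 = kappa / (256 * K).
  by rewrite /rate; field; rewrite !gt_eqF.
have h1 : 8 * (rate t.+1 * eta t.+1 ^+ 2 * energy t w) <= kappa * eta t.+1 / 2 * (1 / 16).
  have -> : rate t.+1 * eta t.+1 ^+ 2 * energy t w =
      (rate t.+1 * eta t.+1) * eta t.+1 * energy t w by ring.
  have -> : kappa * eta t.+1 / 2 * (1 / 16) = 8 * ((rate t.+1 * eta t.+1) * eta t.+1 * K).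
    by rewrite reta; field; rewrite gt_eqF.
  apply: ler_wpM2l; first by rewrite ler0n.
  apply: ler_wpM2l WK.
  exact: mulr_ge0 (mulr_ge0 (ltW r1) (ltW e1)) (ltW e1).
have h2 : 256 * (rate t.+1 ^+ 2 * eta t.+1 ^+ 2 * (Y t w * energy t w)) <=
    rate t.+1 * eta t.+1 * (kappa * Y t w).
  have -> : rate t.+1 * eta t.+1 * (kappa * Y t w) =
     256 * (rate t.+1 ^+ 2 * eta t.+1 ^+ 2 * (Y t w * K)).
    rewrite -exprMn reta; field; rewrite gt_eqF//.
  apply: ler_wpM2l; first by rewrite ler0n.
  apply: ler_wpM2l; first exact: mulr_ge0 (sqr_ge0 _) (sqr_ge0 _).
  exact: ler_wpM2l Y0 _ _ WK.
have h3 : rate t.+1 * (1 - kappa * eta t.+1) <= rate t * (1 - kappa * eta t.+1 / 2).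
  have -> : rate t.+1 * (1 - kappa * eta t.+1) =
    kappa / (256 * K * eta t * eta t.+1) * (eta t * (1 - kappa * eta t.+1)).
    by rewrite /rate; field; rewrite !gt_eqF.
  have -> : rate t * (1 - kappa * eta t.+1 / 2) =
    kappa / (256 * K * eta t * eta t.+1) * (eta t.+1 * (1 - kappa * eta t.+1 / 2)).
    by rewrite /rate; field; rewrite !gt_eqF.
  apply: ler_wpM2l (eta_slow t nt); apply: ltW.
  apply: divr_gt0; first exact: kappa_gt0.
  exact: mulr_gt0 (mulr_gt0 K256 e0) e1.
have := ler_wpM2r Y0 h3.
lra.
Qed.

(** The exponent is bounded by a convex combination of [rate t * Y t w] and [1 / 16]; convexity of
    the exponential turns this into a linear recursion for the moments. *)
Lemma rate_convex_step t w (Q : R) : (n0 <= t)%N -> energy t w <= K -> expR 1 <= Q ->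
  expR (rate t.+1 * Y t w) * expR (8 * (rate t.+1 * eta t.+1 ^+ 2 * energy t w)
     - 2 * rate t.+1 * eta t.+1 * (kappa * Y t w)
     + 256 * (rate t.+1 ^+ 2 * eta t.+1 ^+ 2 * (Y t w * energy t w))) <=
  (1 - kappa * eta t.+1 / 2) * expR (rate t * Y t w) + kappa * eta t.+1 / 2 * Q.
Proof.
move=> nt WK Q1; rewrite -expRD.
have e1 : 0 < eta t.+1 by apply: eta_gt0; exact: leqW.
have a01 : 0 <= kappa * eta t.+1 / 2 <= 1.
  have := eta_small t.+1 (leqW nt); have := mulr_gt0 kappa_gt0 e1.
  by move=> *; apply/andP; split; lra.
have step := rate_step t w nt WK; rewrite -ler_expR in step.
apply: (le_trans step); apply: (le_trans (expR_conv _ _ _ a01)).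
rewrite lerD2l ler_wpM2l//; first by case/andP: a01.
by apply: le_trans Q1; rewrite ler_expR; lra.
Qed.

(** The value [Q] is a fixed point of the recursion [z -> (1 - a) z + a Q]. At time [n0] confinement
    gives [Y <= K], hence the term [rate n0 * K]; the extra 1 ensures [e <= Q]. *)
Lemma decay_moment t : (n0 <= t)%N ->
  (\int[P]_w (\1_(confined K t) w * expR (rate t * Y t w))%:E <=
   (expR (rate n0 * K + 1))%:E)%E.
Proof.
set Q := expR (rate n0 * K + 1).
have mI k : measurable_fun setT (\1_(confined K k) : Omega -> R).
  by apply: measurable_indic; exact: confined_measurable'.
have mYB k : measurable_fun setT (Y k).
  exact: (history_measurable_fun samples_iid k _ (mY k)).
have mE (c : R) k : measurable_fun setT (fun w => expR (c * Y k w)).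
  by apply: measurableT_comp => //; apply: measurable_funM => //; exact: measurable_cst.
have Q1 : expR 1 <= Q.
  by rewrite ler_expR lerDr mulr_ge0// ltW// rate_gt0.
elim: t => [|t IH]; first by move=> /(leq_trans n0_gt0).
rewrite leq_eqVlt => /predU1P[nt|]; last rewrite ltnS => nt.
  apply: (@le_trans _ _ (\int[P]_w Q%:E)%E).
    apply: ge0_le_integral_EFin.
    - exact: measurable_funM.
    - exact: measurable_cst.
    - by move=> w; rewrite mulr_ge0 ?indic_ge0 ?expR_ge0.
    - move=> w; rewrite indicE; case: (boolP (w \in _)) => [/set_mem h|_].
        rewrite mul1r ler_expR nt; apply: ler_wpDr => //.
        rewrite ler_wpM2l//; first by rewrite ltW// rate_gt0// nt.
        by have := confined_energy _ _ _ h; rewrite /energy; have := sqr_ge0 M; lra.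
      by rewrite mul0r expR_ge0.
  by rewrite integral_cst// [X in (_ * X)%E]probability_setT mule1.
have r1 : 0 < rate t.+1 by apply: rate_gt0; exact: leqW.
have e1 : 0 < eta t.+1 by apply: eta_gt0; exact: leqW.
pose a := kappa * eta t.+1 / 2.
have [a0 a1] : 0 <= a /\ 0 <= 1 - a.
  have := eta_small t.+1 (leqW nt); have := mulr_gt0 kappa_gt0 e1.
  by rewrite /a => *; split; lra.
have mh : measurable_fun setT
    ((fun w => \1_(confined K t) w * expR (rate t.+1 * Y t w)) : history t -> R).
  apply: measurable_funM; first by apply: measurable_indic; exact: confined_measurable.
  apply: measurableT_comp => //; apply: measurable_funM; first exact: measurable_cst.
  exact: mY.
have mc : measurable_fun setT ((fun=> rate t.+1) : history t -> R) by exact: measurable_cst.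
have h0 w : 0 <= \1_(confined K t) w * expR (rate t.+1 * Y t w).
  by rewrite mulr_ge0 ?indic_ge0 ?expR_ge0.
have mhB := history_measurable_fun samples_iid t _ mh.
apply: (@le_trans _ _ (\int[P]_w (\1_(confined K t) w * expR (rate t.+1 * Y t w)
    * expR (rate t.+1 * (Y t.+1 w - Y t w)))%:E)%E).
  apply: ge0_le_integral_EFin.
  - exact: measurable_funM.
  - apply: measurable_funM => //; apply: measurableT_comp => //.
    apply: measurable_funM; first exact: measurable_cst.
    exact: measurable_funB.
  - by move=> w; rewrite mulr_ge0 ?indic_ge0 ?expR_ge0.
  - move=> w; rewrite -mulrA -expRD.
    have -> : rate t.+1 * Y t w + rate t.+1 * (Y t.+1 w - Y t w) = rate t.+1 * Y t.+1 w.
      by ring.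
    by rewrite ler_wpM2r ?expR_ge0//; apply: indic_le; exact: confined_le.
apply: (le_trans (integral_td_step gamma01 kernelP muP phi1 lambda0P lambda0_gt0
  samples_iid samples_law eta_ge0 t _ _ mh mc h0 (fun=> ltW r1))).
pose f w := \1_(confined K t) w * expR (rate t * Y t w).
have mf : measurable_fun setT f by exact: measurable_funM.
have f0 w : 0 <= f w by rewrite mulr_ge0 ?indic_ge0 ?expR_ge0.
apply: (@le_trans _ _ (\int[P]_w ((1 - a) * f w + a * Q)%:E)%E).
  apply: ge0_le_integral_EFin.
  - apply: measurable_funM => //; apply: measurableT_comp => //.
    have mW : measurable_fun setT (fun w => Y t w + M ^+ 2).
      by apply: measurable_funD => //; exact: measurable_cst.
    apply: measurable_funD; last first.
      apply: measurable_funM; first exact: measurable_cst.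
      apply: measurable_funM; last exact: measurable_funM.
      exact: measurable_cst.
    apply: measurable_funB.
      apply: measurable_funM; first exact: measurable_cst.
      by apply: measurable_funM => //; exact: measurable_cst.
    apply: measurable_funM; first exact: measurable_cst.
    by apply: measurable_funM => //; exact: measurable_cst.
  - apply: measurable_funD; last exact: measurable_cst.
    by apply: measurable_funM => //; exact: measurable_cst.
  - by move=> w; rewrite mulr_ge0 ?expR_ge0.
  - move=> w; rewrite /f indicE; case: (boolP (w \in _)) => [/set_mem h|_].
      rewrite !mul1r; apply: rate_convex_step => //.
      exact: confined_energy.
    by rewrite !mul0r mulr0 add0r mulr_ge0 ?expR_ge0.
rewrite (ge0_integral_EFinD P (fun w => (1 - a) * f w) (fun=> a * Q)); last 4 first.
- by apply: measurable_funM => //; exact: measurable_cst.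
- exact: measurable_cst.
- by move=> w; rewrite mulr_ge0.
- by move=> _; rewrite mulr_ge0 ?expR_ge0.
rewrite -(integral_EFinZ f _ mf f0 a1) muleC.
rewrite integral_cst// [X in (_ + _ * X)%E]probability_setT mule1.
apply: (@le_trans _ _ ((1 - a)%:E * Q%:E + (a * Q)%:E)%E).
  rewrite leeD2r//; apply: lee_wpmul2l; first by rewrite lee_fin.
  exact: IH.
by rewrite -EFinM -EFinD lee_fin; lra.
Qed.

Definition overshoot x t : set Omega :=
  [set w | confined K t w /\ rate n0 * K + 1 + x < rate t * Y t w].

Lemma overshoot_measurable x t : measurable (overshoot x t).
Proof.
apply: measurableI; first exact: confined_measurable'.
rewrite (_ : (fun w => _) = setT `&` (fun w => rate t * Y t w) @^-1` `]rate n0 * K + 1 + x, +oo[).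
  have mf : measurable_fun setT (fun w => rate t * Y t w).
    apply: measurable_funM; first exact: measurable_cst.
    exact: (history_measurable_fun samples_iid t _ (mY t)).
  by apply: mf => //; exact: measurable_itv.
by apply/seteqP; split => w /=; rewrite in_itv/= andbT // => -[].
Qed.

Lemma prob_overshoot x t : (n0 <= t)%N -> (P (overshoot x t) <= (expR (- x))%:E)%E.
Proof.
move=> nt; have mO := overshoot_measurable x t.
have mf : measurable_fun setT (fun w => \1_(confined K t) w * expR (rate t * Y t w)).
  apply: measurable_funM; first by apply: measurable_indic; exact: confined_measurable'.
  apply: measurableT_comp => //; apply: measurable_funM; first exact: measurable_cst.
  exact: (history_measurable_fun samples_iid t _ (mY t)).
have := markov_indic P _ _ (expR (rate n0 * K + 1 + x)) mO mf (expR_ge0 _).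
have H w : expR (rate n0 * K + 1 + x) * \1_(overshoot x t) w <=
    \1_(confined K t) w * expR (rate t * Y t w).
  rewrite [in leLHS]indicE; case: (boolP (w \in _)) => [/set_mem [h1 h2]|_].
    by rewrite mulr1 indicE mem_set// mul1r ler_expR ltW.
  by rewrite mulr0 mulr_ge0 ?indic_ge0 ?expR_ge0.
move=> /(_ H) /le_trans /(_ (decay_moment t nt)).
have [y ->] : exists y, P (overshoot x t) = y%:E.
  by exists (fine (P (overshoot x t))); rewrite fineK// fin_num_measure.
rewrite -EFinM !lee_fin => h.
have : expR (rate n0 * K + 1 + x) * y <= expR (rate n0 * K + 1 + x) * expR (- x).
  by apply: (le_trans h); rewrite -expRD addrK.
by rewrite ler_pM2l ?expR_gt0.
Qed.

(** Index [i] stands for time [i.+1]. Times before [n0] remove nothing: confinement alone is used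
    there. *)
Definition good_event x T : set Omega :=
  confined K T `\` \big[setU/set0]_(i < T) (if (n0 <= i.+1)%N then overshoot x i.+1 else set0).

Let overshoot'_measurable x i :
  measurable (if (n0 <= i.+1)%N then overshoot x i.+1 else set0).
Proof. by case: ifP => _; [exact: overshoot_measurable|exact: measurable0]. Qed.

Lemma good_event_measurable x T : measurable (good_event x T).
Proof.
apply: measurableD; first exact: confined_measurable'.
by apply: bigsetU_measurable => i _; exact: overshoot'_measurable.
Qed.

Lemma good_event_energy x T w t : good_event x T w -> (t <= T)%N -> energy t w <= K.
Proof. by move=> [h _] tT; exact: h. Qed.

Lemma good_event_rate x T w t : good_event x T w -> (n0 <= t <= T)%N ->
  rate t * Y t w <= rate n0 * K + 1 + x.
Proof.
move=> [h1 h2] /andP[nt tT]; rewrite leNgt; apply/negP => h; apply: h2.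
case: t nt tT h => [|t]; first by move=> /(leq_trans n0_gt0).
move=> nt tT h; rewrite -(bigcup_mkord T (fun i =>
  if (n0 <= i.+1)%N then overshoot x i.+1 else set0)); exists t => //=.
rewrite nt; split => // k kt; apply: h1; exact: leq_trans tT.
Qed.

Lemma prob_good_event x T (u : R) : (P (~` confined K T) <= u%:E)%E ->
  ((1 - (u + T%:R * expR (- x)))%:E <= P (good_event x T))%E.
Proof.
move=> Pu.
have mG := good_event_measurable x T.
have PC : (P (~` good_event x T) <= (u + T%:R * expR (- x))%:E)%E.
  pose U := \big[setU/set0]_(i < T) (if (n0 <= i.+1)%N then overshoot x i.+1 else set0).
  have mU : measurable U by apply: bigsetU_measurable => i _; exact: overshoot'_measurable.
  have mC := confined_measurable' K T.
  have sub : ~` good_event x T `<=` (~` confined K T) `|` U.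
    move=> w; by rewrite /good_event setDE setCI setCK.
  apply: (@le_trans _ _ (P ((~` confined K T) `|` U))).
    apply: le_measure; rewrite ?inE//; first exact: measurableC.
    by apply: measurableU => //; exact: measurableC.
  apply: (@le_trans _ _ (P (~` confined K T) + P U)%E).
    by apply: measureU2 => //; exact: measurableC.
  rewrite EFinD; apply: leeD => //.
  apply: (@le_trans _ _ (\sum_(i < T) P (if (n0 <= i.+1)%N then overshoot x i.+1 else set0))%E).
    apply: (@Boole_inequality _ _ _ P (fun i =>
      if (n0 <= i.+1)%N then overshoot x i.+1 else set0) T) => i _.
    exact: overshoot'_measurable.
  apply: (@le_trans _ _ (\sum_(i < T) (expR (- x))%:E)%E).
    apply: lee_sum => i _; case: ifP => [nt|_]; first exact: prob_overshoot.
    by rewrite measure0 lee_fin expR_ge0.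
  by rewrite sumEFin big_const_ord iter_addr_0 mulr_natl.
have := probability_setC P mG; move: PC.
have [y yE] : exists y, P (good_event x T) = y%:E.
  by exists (fine (P (good_event x T))); rewrite fineK// fin_num_measure.
rewrite yE => + PCE; rewrite PCE -EFinB !lee_fin; lra.
Qed.

End decay.
End two_stage.

(** * Real powers and sums of negative powers *)

Section step_sizes.
Context {R : realType}.
Implicit Types x y z s alpha : R.

Lemma powR_expR x y : 0 < x -> x `^ y = expR (y * ln x).
Proof. by move=> x0; rewrite /powR gt_eqF. Qed.

Lemma expR1_le4 : expR 1 <= 4 :> R.
Proof.
have h : 1 / 2 <= expR (- (1 / 2)) :> R by apply: le_trans (expR_ge1Dx _); lra.
have e : expR (1 / 2) <= 2 :> R.
  rewrite -[expR _]invrK -expRN -[leRHS]invrK lef_pV2 ?posrE ?expR_gt0//; lra.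
have -> : (1 : R) = 1 / 2 + 1 / 2 by lra.
have := expR_gt0 (1 / 2 : R); rewrite expRD; nra.
Qed.

Lemma ln9_ge1 : 1 <= ln 9 :> R.
Proof.
rewrite -[leLHS]expRK ler_ln ?posrE ?expR_gt0 ?ltr0n//.
by apply: le_trans expR1_le4 _; rewrite ler_nat.
Qed.

(** Bernoulli's inequality, from convexity of the exponential between 0 and [ln (1 + y)]. *)
Lemma powR_concave y alpha : 0 <= y -> 0 <= alpha <= 1 ->
  (1 + y) `^ alpha <= 1 + alpha * y.
Proof.
move=> y0 a01; have y1 : 0 < 1 + y by lra.
rewrite powR_expR//; have := expR_conv alpha 0 (ln (1 + y)) a01.
by rewrite mulr0 add0r expR0 lnK ?posrE//; lra.
Qed.

(** Comparison of a decreasing power with its integral over [[n, n+1]], without integration: it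
    follows from [1 / (n+1) <= ln ((n+1) / n)] and [1 + u <= e^u]. *)
Lemma powRN_telescope (n : nat) s : (0 < n)%N -> 0 < s ->
  n.+1%:R `^ (- (s + 1)) <= (n%:R `^ (- s) - n.+1%:R `^ (- s)) / s.
Proof.
move=> n0 s0.
have N0 : 0 < n%:R :> R by rewrite ltr0n.
have m0 : 0 < n.+1%:R :> R by rewrite ltr0n.
rewrite ler_pdivlMr// !powR_expR//.
have -> : - (s + 1) * ln n.+1%:R = - s * ln n.+1%:R + - ln n.+1%:R by ring.
rewrite expRD expRN lnK ?posrE//.
have -> : - s * ln n%:R = - s * ln n.+1%:R + s * (ln n.+1%:R - ln n%:R) by ring.
rewrite expRD -mulrA -[X in _ <= _ - X]mulr1 -mulrBr ler_wpM2l ?expR_ge0//.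
have h : n.+1%:R^-1 <= ln n.+1%:R - ln n%:R :> R.
  rewrite -ln_div ?posrE//.
  have -> : n.+1%:R / n%:R = (n%:R / n.+1%:R)^-1 :> R by rewrite invf_div.
  have q0 : 0 < n%:R / n.+1%:R :> R by rewrite divr_gt0.
  rewrite lnV ?posrE// lerNr -ler_expR lnK ?posrE//.
  have -> : n%:R / n.+1%:R = 1 + - n.+1%:R^-1 :> R.
    by rewrite -natr1; field; rewrite natr1 gt_eqF.
  exact: expR_ge1Dx.
apply: (@le_trans _ _ (s * (ln n.+1%:R - ln n%:R))).
  by rewrite mulrC; exact: ler_wpM2l (ltW s0) _ _ h.
by rewrite lerBrDl; exact: expR_ge1Dx.
Qed.

Lemma sum_powRN_le s (t : nat) : 0 < s ->
  \sum_(1 <= k < t.+1) k%:R `^ (- (s + 1)) <= (s + 1) / s.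
Proof.
move=> s0; case: t => [|t]; first by rewrite big_geq// divr_ge0//; lra.
(* The induction requires the sharper bound that keeps the telescoped remainder. *)
apply: (@le_trans _ _ ((s + 1) / s - t.+1%:R `^ (- s) / s)); last first.
  by rewrite gerBl divr_ge0 ?powR_ge0// ltW.
elim: t => [|t IH].
  by rewrite big_nat1 !powR1 -mulrBl addrK divff ?gt_eqF.
rewrite big_nat_recr//=; have := powRN_telescope t.+1 s isT s0.
by move: IH; rewrite mulrBl; lra.
Qed.

End step_sizes.

(** * The step sizes, the burn-in time and the resulting deterministic bound *)

Section schedule.
Context {R : realType}.
Variables (alpha delta kappa : R).
Hypothesis alpha_bounds : 1 / 2 < alpha < 1.
Hypothesis delta01 : 0 < delta < 1.
Hypothesis kappa_gt0 : 0 < kappa.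
Hypothesis kappa_le1 : kappa <= 1.

Let a12 : 1 / 2 < alpha. Proof. by case/andP: alpha_bounds. Qed.
Let a1 : alpha < 1. Proof. by case/andP: alpha_bounds. Qed.
Let d0 : 0 < delta. Proof. by case/andP: delta01. Qed.
Let d1 : delta < 1. Proof. by case/andP: delta01. Qed.

Local Ltac alra := have := a12; have := a1; lra.

Definition log_delta : R := ln (9 / delta).

Lemma log_delta_ge1 : 1 <= log_delta.
Proof.
apply: le_trans ln9_ge1 _.
rewrite /log_delta ler_ln ?posrE ?divr_gt0 ?ltr0n//.
by rewrite ler_pdivlMr// ler_piMr ?ler0n// ltW.
Qed.

(** The divisor 24 is large enough because [24^2 = 576] exceeds [2 * 264], where 264 is the constant
    of stage 1. *)
Definition eta_init : R := Num.sqrt ((2 * alpha - 1) / log_delta) / 24.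

Lemma eta_init_sqr : eta_init ^+ 2 = (2 * alpha - 1) / log_delta / 576.
Proof.
have L := log_delta_ge1.
rewrite /eta_init expr_div_n sqr_sqrtr; first by congr (_ / _); ring.
by apply: divr_ge0; alra.
Qed.

Lemma eta_init_gt0 : 0 < eta_init.
Proof.
have L := log_delta_ge1.
by rewrite divr_gt0 ?ltr0n// sqrtr_gt0 divr_gt0//; alra.
Qed.

Lemma eta_init_le1 : eta_init <= 1.
Proof.
have L := log_delta_ge1; have e0 := eta_init_gt0.
rewrite -(@ler_pXn2r _ 2)// ?nnegrE ?ler01 ?ltW// expr1n eta_init_sqr.
have : (2 * alpha - 1) / log_delta <= 1 by rewrite ler_pdivrMr; alra.
alra.
Qed.

Definition eta_sched (k : nat) : R := eta_init * k%:R `^ (- alpha).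

Lemma eta_sched_ge0 k : 0 <= eta_sched k.
Proof. by rewrite mulr_ge0 ?powR_ge0// ltW// eta_init_gt0. Qed.

Lemma eta_sched_gt0 k : (0 < k)%N -> 0 < eta_sched k.
Proof. by move=> k0; rewrite mulr_gt0 ?eta_init_gt0// powR_gt0// ltr0n. Qed.

Lemma eta_sched_le1 k : (0 < k)%N -> eta_sched k <= 1.
Proof.
move=> k0; have e0 := eta_init_gt0; have e1 := eta_init_le1.
apply: mulr_ile1 => //; rewrite ?powR_ge0//; first exact: ltW.
rewrite powRN invf_le1 ?powR_gt0 ?ltr0n//.
have k1 : 1 <= k%:R :> R by rewrite ler1n.
apply: (@le_trans _ _ (k%:R `^ 0)); first by rewrite powRr0.
by apply: ler_powR => //; alra.
Qed.

(** The series of [k^(-2 alpha)] is at most [2 alpha / (2 alpha - 1)], and [eta_init] cancels the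
    denominator and one logarithm. This is the budget [v] of [prob_not_confined] with both [p] and
    [v] equal to [log_delta]. *)
Lemma sum_eta_sched_sqr t :
  \sum_(1 <= k < t.+1) 264 * log_delta ^+ 2 * eta_sched k ^+ 2 <= log_delta.
Proof.
have L := log_delta_ge1.
have sE k : eta_sched k ^+ 2 = eta_init ^+ 2 * k%:R `^ (- ((2 * alpha - 1) + 1)).
  rewrite exprMn; congr (_ * _).
  by rewrite -powR_mulrn ?powR_ge0// -powRrM; congr (_ `^ _); ring.
under eq_bigr do rewrite sE mulrA.
rewrite -mulr_sumr.
have s0 : 0 < 2 * alpha - 1 by alra.
have S := sum_powRN_le (2 * alpha - 1) t s0.
rewrite eta_init_sqr.
have -> : 264 * log_delta ^+ 2 * ((2 * alpha - 1) / log_delta / 576) =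
   264 / 576 * log_delta * (2 * alpha - 1) by field; rewrite gt_eqF//; alra.
have c0 : 0 <= 264 / 576 * log_delta * (2 * alpha - 1).
  have L0 : 0 <= log_delta by alra.
  exact: mulr_ge0 (mulr_ge0 (divr_ge0 (ler0n _ 264) (ler0n _ 576)) L0) (ltW s0).
apply: (le_trans (ler_wpM2l c0 S)).
have -> : 264 / 576 * log_delta * (2 * alpha - 1) * ((2 * alpha - 1 + 1) / (2 * alpha - 1))
   = 264 / 576 * log_delta * (2 * alpha) by field; rewrite gt_eqF.
have := ler_wpM2l (le_trans ler01 L) (ltW a1); alra.
Qed.

Definition contraction_rate : R := kappa * eta_init / (4 * alpha).

Lemma contraction_rate_gt0 : 0 < contraction_rate.
Proof. by apply: divr_gt0; [exact: mulr_gt0 kappa_gt0 eta_init_gt0|alra]. Qed.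

Lemma contraction_rate_le1 : contraction_rate <= 1.
Proof.
have e0 := eta_init_gt0; have e1 := eta_init_le1.
rewrite /contraction_rate ler_pdivrMr; last alra.
have : kappa * eta_init <= 1 by rewrite mulr_ile1// ltW.
alra.
Qed.

(** The solution [t] of [kappa * eta_init * t^(1 - alpha) = 4 alpha]. *)
Definition burn_in : R := contraction_rate `^ (- (1 - alpha)^-1).

Lemma burn_in_gt0 : 0 < burn_in. Proof. exact: powR_gt0 contraction_rate_gt0. Qed.

Lemma burn_in_ge1 : 1 <= burn_in.
Proof.
have c0 := contraction_rate_gt0; have c1 := contraction_rate_le1.
rewrite /burn_in powRN -powR_inv1 ?powR_ge0//.
rewrite powR_inv1 ?powR_ge0// invf_ge1 ?powR_gt0//.
apply: (@le_trans _ _ (contraction_rate `^ 0)); last by rewrite powRr0.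
apply: ger_powR; first by rewrite c0.
by rewrite invr_ge0; alra.
Qed.

Lemma burn_in_pow y : burn_in `^ y = contraction_rate `^ (- (y / (1 - alpha))).
Proof. by rewrite /burn_in -powRrM; congr (_ `^ _); ring. Qed.

Lemma burn_inE : burn_in `^ (1 - alpha) = contraction_rate^-1.
Proof.
rewrite burn_in_pow divff; last by rewrite gt_eqF//; alra.
by rewrite powR_inv1// ltW// contraction_rate_gt0.
Qed.

Definition start : nat := (Num.truncn burn_in).+1.

Lemma start_gt_burn_in : burn_in < start%:R.
Proof. by rewrite /start; apply: truncnS_gt. Qed.

Lemma start_le : start%:R <= 2 * burn_in.
Proof.
have b1 := burn_in_ge1.
have : (Num.truncn burn_in)%:R <= burn_in by rewrite truncn_le// ltW// burn_in_gt0.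
by rewrite /start -natr1; alra.
Qed.

Lemma lt_start_le (t : nat) : (t < start)%N -> t%:R <= burn_in.
Proof.
rewrite /start ltnS => tb.
apply: (@le_trans _ _ (Num.truncn burn_in)%:R); first by rewrite ler_nat.
by rewrite truncn_le// ltW// burn_in_gt0.
Qed.

(** The ratio of consecutive steps is [(1 + 1/t)^alpha <= 1 + alpha / t]. Past the burn-in time
    [alpha / t <= x / 2] with [x = kappa * eta_sched t.+1], and [(1 + x/2) (1 - x) <= 1 - x/2]. *)
Lemma eta_sched_slow t : (start <= t)%N ->
  eta_sched t * (1 - kappa * eta_sched t.+1) <=
  eta_sched t.+1 * (1 - kappa * eta_sched t.+1 / 2).
Proof.
move=> st; have t0 : (0 < t)%N by exact: leq_trans st.
have T0 : 0 < t%:R :> R by rewrite ltr0n.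
have T1 : 0 < t.+1%:R :> R by rewrite ltr0n.
have e0 := eta_init_gt0.
have es0 := eta_sched_gt0 t.+1 isT.
have ratio : eta_sched t = eta_sched t.+1 * (1 + t%:R^-1) `^ alpha.
  rewrite /eta_sched -mulrA; congr (_ * _); rewrite !powRN.
  have -> : 1 + t%:R^-1 = t.+1%:R / t%:R :> R.
    by rewrite -natr1; field; rewrite gt_eqF.
  have tV : t%:R^-1 `^ alpha = (t%:R `^ alpha)^-1 :> R.
    by rewrite !powR_expR ?invr_gt0// lnV ?posrE// mulrN expRN.
  rewrite powRM ?invr_ge0 ?ler0n// tV.
  by rewrite mulrA mulVf ?mul1r// gt_eqF// powR_gt0.
have growth : (1 + t%:R^-1) `^ alpha <= 1 + kappa * eta_sched t.+1 / 2.
  apply: (le_trans (powR_concave _ _ _ _)).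
  - by rewrite invr_ge0 ler0n.
  - by apply/andP; split; alra.
  rewrite lerD2l.
  have tt : t%:R^-1 <= 2 / t.+1%:R :> R.
    rewrite ler_pdivlMr// ler_pdivrMl// -natr1.
    have : 1 <= t%:R :> R by rewrite ler1n.
    alra.
  have big : contraction_rate^-1 <= t.+1%:R `^ (1 - alpha).
    rewrite -burn_inE; apply: ge0_ler_powR; rewrite ?nnegrE ?ler0n//.
    - by alra.
    - by rewrite ltW// burn_in_gt0.
    - apply: ltW; apply: lt_le_trans start_gt_burn_in _.
      by rewrite ler_nat; exact: leqW.
  have pE : t.+1%:R `^ (- alpha) = t.+1%:R `^ (1 - alpha) / t.+1%:R :> R.
    rewrite -[X in _ / X]powRr1 ?ler0n// -powRB; first by congr (_ `^ _); ring.
    by rewrite (gt_eqF T1) implybT.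
  have h : 4 * alpha / t.+1%:R <= kappa * eta_sched t.+1.
    rewrite /eta_sched pE mulrA mulrA ler_pM2r ?invr_gt0//.
    have -> : 4 * alpha = kappa * eta_init * contraction_rate^-1.
      by rewrite /contraction_rate; field; rewrite !gt_eqF//; alra.
    by rewrite ler_wpM2l// mulr_ge0 ?ltW.
  have a0 : 0 <= alpha by alra.
  move: h (ler_wpM2l a0 tt); move: (t.+1%:R^-1) (t%:R^-1) (kappa * _) => u v z.
  by move=> h1 h2; lra.
rewrite ratio -mulrA ler_pM2l//.
have x1 : kappa * eta_sched t.+1 <= 1.
  by rewrite mulr_ile1 ?eta_sched_le1// ltW.
have x0 : 0 <= kappa * eta_sched t.+1 by rewrite mulr_ge0 ?ltW.
have g0 : 0 <= 1 - kappa * eta_sched t.+1 by alra.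
apply: (le_trans (ler_wpM2r g0 growth)).
set x := kappa * _; have := sqr_ge0 x; alra.
Qed.

(** At [x = log_delta] this is an equality by the choice of [eta_init]. It lets bare constants be
    charged to the factor [eta_init^2 x / (2 alpha - 1)] of the final bound. *)
Lemma eta_init_budget x : log_delta <= x ->
  1 <= 576 * (eta_init ^+ 2 / (2 * alpha - 1) * x).
Proof.
move=> Lx; have L1 := log_delta_ge1.
have L0 : 0 < log_delta by alra.
rewrite eta_init_sqr.
have -> : 576 * ((2 * alpha - 1) / log_delta / 576 / (2 * alpha - 1) * x) = x / log_delta.
  by field; rewrite !gt_eqF//; alra.
by rewrite ler_pdivlMr// mul1r.
Qed.

(** Before [start] the ratio [(burn_in / t)^alpha] is at least 1 and confinement suffices.
    Afterwards the rate inequality is solved for [Y], and [1408 = 2 * 576 + 128 * 2] collects the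
    contributions of [term1] and [term2]. *)
Lemma decay_bound K Y x (t : nat) : 0 < K -> log_delta <= x -> (0 < t)%N ->
  ((t < start)%N -> Y <= K) ->
  ((start <= t)%N -> kappa / (256 * K * eta_sched t) * Y <=
     kappa / (256 * K * eta_sched start) * K + 1 + x) ->
  Y <= 1408 * (eta_init ^+ 2 / (2 * alpha - 1) * x) * K * (burn_in `^ alpha * t%:R `^ (- alpha)).
Proof.
move=> K0 Lx t0 early late.
have L1 := log_delta_ge1; have x1 : 1 <= x by exact: le_trans Lx.
have G1 := eta_init_budget x Lx; set G := _ * x in G1 *.
have t1 : 0 < t%:R :> R by rewrite ltr0n.
have b0 := burn_in_gt0; have b1 := burn_in_ge1.
have ba0 : 0 < burn_in `^ alpha by exact: powR_gt0.
have ta0 : 0 < t%:R `^ (- alpha) :> R by exact: powR_gt0.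
have al0 : 0 <= alpha by alra.
have BT0 : 0 < K * (burn_in `^ alpha * t%:R `^ (- alpha)).
  exact: mulr_gt0 K0 (mulr_gt0 ba0 ta0).
have [ts|st] := ltnP t start.
  have ratio : 1 <= burn_in `^ alpha * t%:R `^ (- alpha).
    rewrite powRN ler_pdivlMr ?powR_gt0// mul1r.
    apply: ge0_ler_powR; rewrite ?nnegrE ?ler0n ?(ltW b0)//.
    exact: lt_start_le.
  have KB : K <= K * (burn_in `^ alpha * t%:R `^ (- alpha)) by rewrite ler_peMr// ltW.
  apply: (le_trans (early ts)); apply: (le_trans KB).
  rewrite -mulrA ler_peMl ?(ltW BT0)//; lra.
have {late} := late st.
have e0 := eta_init_gt0.
have et0 := eta_sched_gt0 t t0.
have es0 : 0 < eta_sched start by exact: eta_sched_gt0.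
have s1 : 0 < start%:R :> R by rewrite ltr0n.
have D0 : 0 < 256 * K * eta_sched t.
  exact: mulr_gt0 (mulr_gt0 (ltr0Sn _ 255) K0) et0.
have -> : kappa / (256 * K * eta_sched t) * Y = Y / (256 * K * eta_sched t / kappa).
  by field; rewrite !gt_eqF.
rewrite ler_pdivrMr ?divr_gt0// => Yle.
apply: (le_trans Yle).
have -> : (kappa / (256 * K * eta_sched start) * K + 1 + x) * (256 * K * eta_sched t / kappa)
    = K * (eta_sched t / eta_sched start) + 256 * K * (1 + x) * (eta_sched t / kappa).
  by field; rewrite !gt_eqF.
have term1 : eta_sched t / eta_sched start <= 2 * (burn_in `^ alpha * t%:R `^ (- alpha)).
  have -> : eta_sched t / eta_sched start = start%:R `^ alpha * t%:R `^ (- alpha).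
    rewrite /eta_sched [start%:R `^ (- _)]powRN; field.
    by rewrite !gt_eqF// powR_gt0.
  rewrite mulrA ler_wpM2r ?(ltW ta0)//.
  apply: (@le_trans _ _ ((2 * burn_in) `^ alpha)).
    apply: ge0_ler_powR; rewrite ?nnegrE ?ler0n//; last exact: start_le.
    by rewrite mulr_ge0// ltW.
  rewrite powRM ?ler0n ?(ltW b0)// ler_wpM2r ?(ltW ba0)//.
  have two1 : 1 <= 2 :> R by rewrite ler1n.
  by apply: ler1_powR => //; exact: ltW.
(* The power [1 - alpha] of [burn_in] may be raised to [alpha] because [burn_in >= 1] and
   [alpha > 1/2]; the latter also gives [4 alpha >= 2]. *)
have term2 : eta_sched t / kappa <=
    eta_init ^+ 2 / 2 * (burn_in `^ alpha * t%:R `^ (- alpha)).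
  have -> : eta_sched t / kappa =
      eta_init ^+ 2 / (4 * alpha) * burn_in `^ (1 - alpha) * t%:R `^ (- alpha).
    rewrite burn_inE /eta_sched /contraction_rate; field.
    by rewrite !gt_eqF//; alra.
  rewrite mulrA ler_wpM2r ?(ltW ta0)//.
  apply: ler_pM.
  - by apply: divr_ge0; [exact: sqr_ge0|alra].
  - exact: powR_ge0.
  - rewrite ler_wpM2l ?sqr_ge0// lef_pV2 ?posrE; alra.
  - by apply: ler_powR => //; alra.
have q0 : 0 <= 256 * K * (1 + x).
  apply: mulr_ge0; first exact: mulr_ge0 (ler0n _ 256) (ltW K0).
  lra.
apply: (le_trans (lerD (ler_wpM2l (ltW K0) term1) (ler_wpM2l q0 term2))).
have GE : eta_init ^+ 2 * x <= G.
  rewrite /G ler_wpM2r//; first lra.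
  by rewrite ler_pdivlMr; [rewrite ler_piMr ?sqr_ge0//; alra|alra].
have ex : eta_init ^+ 2 * (1 + x) <= 2 * G.
  have := ler_wpM2l (sqr_ge0 eta_init) x1; lra.
set B := burn_in `^ alpha * _ in BT0 *.
have -> : K * (2 * B) + 256 * K * (1 + x) * (eta_init ^+ 2 / 2 * B) =
  (2 + 128 * (eta_init ^+ 2 * (1 + x))) * (K * B) by field.
have -> : 1408 * G * K * B = (1408 * G) * (K * B) by ring.
by rewrite ler_wpM2r ?(ltW BT0)//; lra.
Qed.

End schedule.

(** * Assembly of the two stages *)

Theorem mainTheorem5 (R : realType) :
  exists C : R, 0 < C /\
  forall (S : finType) (d : nat) (gamma : R) (Pk : S -> S -> R) (mu : S -> R)
    (r : S -> R) (phi : S -> 'cV[R]_d) (lambda0 : R)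
    (dO : measure_display) (Omega : measurableType dO) (P : probability Omega R)
    (s s' : nat -> Omega -> S) (rw : nat -> Omega -> R),
    0 <= gamma < 1 ->
    is_kernel Pk ->
    unique_stationary Pk mu ->
    (forall a, 0 <= r a <= 1) ->
    (forall a, norm2 (phi a) <= 1) ->
    is_lambda_min (TD_Sigma mu phi) lambda0 ->
    0 < lambda0 ->
    iid_samples P s s' rw ->
    sample_law P s s' rw Pk mu r ->
    forall alpha delta : R, 1 / 2 < alpha < 1 -> 0 < delta < 1 ->
    exists eta0 : R, 0 < eta0 /\
    forall T : nat,
      exists F : set Omega, measurable F /\ ((1 - delta)%:E <= P F)%E /\
      forall w, F w ->
      forall t : nat, (1 <= t <= T)%N ->
        let eta := fun k : nat => eta0 * (k%:R `^ (- alpha)) in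
        let theta_t := TD_iter gamma phi eta (fun k => s k w) (fun k => s' k w)
                         (fun k => rw k w) t in
        let thstar := theta_star gamma Pk mu r phi in
        norm2 (theta_t - thstar) <=
          C * (eta0 / Num.sqrt (2 * alpha - 1)
               * (((1 - gamma) * lambda0 * eta0 / (4 * alpha))
                    `^ (- (alpha / (2 * (1 - alpha)))))
               * Num.sqrt (ln (9 * T%:R / delta))
               * (2 * norm2 thstar + 1)
               * (t%:R `^ (- (alpha / 2)))).
Proof.
(* The squared error is at most [1408 K] times the squared rate, where [K = e^2 W0] and
   [W0 <= 2 M^2]; [54^2 = 2916] covers [2 * 1408], and [expR 1] is the root of [e^2]. *)
exists (54 * expR 1); split; first by rewrite mulr_gt0 ?ltr0n ?expR_gt0.
move=> S d gamma Pk mu r phi lambda0 dO Omega P s s' rw gamma01 kernelP [muP _] _ phi1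
  lambda0P lambda0_gt0 iid law alpha delta alpha_bounds delta01.
have [a12 a1] := andP alpha_bounds; have [d0 d1] := andP delta01.
have [g0 g1] := andP gamma01.
pose kappa := (1 - gamma) * lambda0.
have kappa0 : 0 < kappa by rewrite mulr_gt0// subr_gt0.
have kappa1 : kappa <= 1.
  have := lambda0_le1 muP phi1 lambda0P; have := ltW lambda0_gt0 => *.
  by rewrite mulr_ile1//; lra.
exists (eta_init alpha delta); split; first exact: eta_init_gt0.
(* For [T = 0] there is no time to control, and the logarithm of [9 * T / delta] would be taken at
   0. *)
move=> T; have [->|T0] := posnP T.
  exists setT; split; first exact: measurableT.
  split; first by rewrite probability_setT lee_fin; lra.
  by move=> w _ t /andP[t0 /(leq_trans t0)].
pose eta := eta_sched alpha delta.
have eta0 k : 0 <= eta k by exact: eta_sched_ge0.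
pose L := log_delta delta; pose x := ln (9 * T%:R / delta).
have L1 : 1 <= L by exact: log_delta_ge1.
have T1 : 1 <= T%:R :> R by rewrite ler1n.
have Lx : L <= x.
  rewrite /L /log_delta /x ler_ln ?posrE.
  - by rewrite ler_pM2r ?invr_gt0// ler_peMr// ler0n.
  - by rewrite divr_gt0// ltr0n.
  - by rewrite divr_gt0// mulr_gt0 ?ltr0n.
pose thstar := theta_star gamma Pk mu r phi.
pose W0 := dot thstar thstar + (2 * norm2 thstar + 1) ^+ 2.
have W0E w : @energy R dO Omega S d gamma s s' rw Pk mu r phi eta 0 w = W0.
  rewrite /energy /td_sqerr /sqerr /td_path /=.
  by rewrite sub0r dotNl dotNr opprK.
have W0_gt0 : 0 < W0 by rewrite -(W0E point); exact: energy_gt0.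
pose K := expR 2 * W0.
have K0 : 0 < K by rewrite mulr_gt0 ?expR_gt0.
pose n0 := start alpha delta kappa.
have eta_pos t : (n0 <= t)%N -> 0 < eta t.
  by move=> nt; apply: eta_sched_gt0 => //; exact: leq_trans nt.
have eta_small t : (n0 <= t)%N -> kappa * eta t <= 2.
  move=> nt; have t0 : (0 < t)%N by exact: leq_trans nt.
  have := eta_sched_le1 _ _ alpha_bounds delta01 _ t0; rewrite -/(eta t) => e1.
  have : kappa * eta t <= 1 by rewrite mulr_ile1// ltW.
  lra.
have eta_slow t : (n0 <= t)%N ->
    eta t * (1 - kappa * eta t.+1) <= eta t.+1 * (1 - kappa * eta t.+1 / 2).
  exact: eta_sched_slow.
(* With [p = v = L] the exit probability is at most [e^(-L) = delta / 9]. *)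
have conf := prob_not_confined gamma01 kernelP muP phi1 lambda0P lambda0_gt0 iid law eta0
  L L1 W0 T L W0E (sum_eta_sched_sqr _ _ alpha_bounds delta01 T).
have prob := prob_good_event gamma01 kernelP muP phi1 lambda0P lambda0_gt0 iid law eta0
  K n0 K0 isT eta_pos eta_small eta_slow x T _ conf.
exists (@good_event R dO Omega S d gamma s s' rw Pk mu r phi lambda0 eta K n0 x T).
split; first by refine (good_event_measurable iid K n0 x T).
split.
  (* The failures add up to [delta / 9 + T * (delta / (9 T)) = 2 delta / 9], less than [delta]. *)
  apply: le_trans prob; rewrite lee_fin.
  have -> : L - 2 * L = - L by ring.
  rewrite !expRN /L /log_delta /x !lnK ?posrE.
  - have -> : (9 / delta)^-1 + T%:R * (9 * T%:R / delta)^-1 = 2 / 9 * delta.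
      by field; rewrite !gt_eqF//; lra.
    by lra.
  - by rewrite divr_gt0// mulr_gt0 ?ltr0n.
  - by rewrite divr_gt0// ltr0n.
move=> w Fw t /andP[t0 tT] /=.
rewrite -[TD_iter _ _ _ _ _ _ _]/(@td_path R dO Omega S d gamma s s' rw phi eta t w) -/thstar.
set Delta := _ - thstar; set M := 2 * norm2 thstar + 1.
have n0' := norm2_ge0 thstar.
have M1 : 1 <= M by rewrite /M; lra.
have eK := good_event_energy K n0 x T w t Fw tT.
have Y : dot Delta Delta <= 1408 * (eta_init alpha delta ^+ 2 / (2 * alpha - 1) * x) * K
    * (burn_in alpha delta kappa `^ alpha * t%:R `^ (- alpha)).
  apply: decay_bound => //.
  - move=> _; apply: le_trans eK; rewrite /energy lerDl; exact: sqr_ge0.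
  - move=> nt; apply: (good_event_rate K n0 isT x T w t Fw).
    by rewrite nt tT.
have W0M : W0 <= 2 * M ^+ 2.
  rewrite /W0 -/M -norm2_sqr; have : norm2 thstar ^+ 2 <= M ^+ 2.
    by rewrite ler_sqr ?nnegrE /M//; lra.
  lra.
have e0 := eta_init_gt0 _ _ alpha_bounds delta01.
have x0 : 0 < x by exact: lt_le_trans ltr01 (le_trans L1 Lx).
have s0 : 0 < 2 * alpha - 1 by lra.
have tR0 : 0 < t%:R :> R by rewrite ltr0n.
apply: norm2_dot_le.
  apply: mulr_ge0; first exact: mulr_ge0 (ler0n _ 54) (expR_ge0 1).
  apply: mulr_ge0; last exact: powR_ge0.
  apply: mulr_ge0; last by rewrite -/M; lra.
  apply: mulr_ge0; last exact: sqrtr_ge0.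
  apply: mulr_ge0; last exact: powR_ge0.
  by apply: divr_ge0; [exact: ltW|exact: sqrtr_ge0].
apply: (le_trans Y).
have c0 := contraction_rate_gt0 _ _ _ alpha_bounds delta01 kappa0.
rewrite burn_in_pow.
set rho := contraction_rate _ _ _ in c0 *.
rewrite -[_ * _ / (4 * alpha)]/rho.
rewrite -/x; move: (eta_init alpha delta) e0 => e e0.
rewrite !exprMn !exprVn !sqr_sqrtr ?(ltW x0) ?(ltW s0)//.
have -> : (rho `^ (- (alpha / (2 * (1 - alpha))))) ^+ 2 = rho `^ (- (alpha / (1 - alpha))).
  rewrite -powR_mulrn ?powR_ge0// -powRrM; congr (_ `^ _); field.
  by rewrite gt_eqF//; lra.
have -> : (t%:R `^ (- (alpha / 2))) ^+ 2 = t%:R `^ (- alpha) :> R.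
  by rewrite -powR_mulrn ?powR_ge0// -powRrM; congr (_ `^ _); field.
have -> : expR 1 ^+ 2 = expR 2 :> R by rewrite -expRM_natl mulr1.
set q := e ^+ 2 / (2 * alpha - 1).
set B := rho `^ _; set D := t%:R `^ _.
have q0 : 0 < q by rewrite divr_gt0 ?exprn_gt0.
have Z0 : 0 <= q * x * expR 2 * (B * D).
  apply: mulr_ge0; last exact: mulr_ge0 (powR_ge0 _ _) (powR_ge0 _ _).
  apply: mulr_ge0; last exact: expR_ge0.
  exact: mulr_ge0 (ltW q0) (ltW x0).
have -> : 1408 * (q * x) * K * (B * D) = (q * x * expR 2 * (B * D)) * (1408 * W0).
  by rewrite /K; ring.
have -> : 54 ^+ 2 * expR 2 * (q * B * x * M ^+ 2 * D)
   = (q * x * expR 2 * (B * D)) * (54 ^+ 2 * M ^+ 2) by ring.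
apply: (ler_wpM2l Z0).
have := sqr_ge0 M; lra.
Qed.
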